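(* The boundary of the extended phase is at positive distance from each of the critical lines $\{p\in\mathcal T:p_1=p_c\}$, $\{p\in\mathcal T:p_2=p_c\}$ and $\{p\in\mathcal T:p_3=p_c\}$. In other words, the (closed) extended phase is bounded away from these three lines.
   Context: Let $\mathcal L=2\mathbb Z^3\cup(2\mathbb Z^3+(1,1,1))$ and consider its Voronoi tessellation of $\mathbb R^3$ (by truncated octahedra). Cells are indexed by their centers $v\in\mathcal L$; cells $v,w$ are adjacent (share a face) iff $v-w\in\{(\pm2,0,0),(0,\pm2,0),(0,0,\pm2)\}$ or $v-w\in\{(\pm1,\pm1,\pm1)\}$. Faces, edges and vertices of the tessellation correspond bijectively to sets of $2$, $3$ and $4$ mutually adjacent cells respectively; incidence corresponds to inclusion. $p_c=p_c^{\mathrm{site}}(\mathcal L)$ is the critical probability for independent site percolation on the graph $\mathcal L$ with this adjacency. Let $\mathcal T=\{p\in[0,1]^3:p_1+p_2+p_3=1\}$. For $p\in\mathcal T$, $\mathbb P_p$ is the law of the random coloring in which each cell independently gets color $i\in\{1,2,3\}$ (red, yellow, blue) with probability $p_i$. A tricolor edge is an edge of the tessellation whose three incident cells have three different colors. Tricolor edges form disjoint loops and/or infinite paths. A tricolor path is a path (along the edges of the tessellation) of tricolor edges. For $n\ge1$ an integer, let $A_n=([-3n,3n]^3\setminus[-n,n]^3)\cap\mathcal L$. $E_n$ is the event that there is a tricolor path from a vertex on the interior boundary of $A_n$ (a vertex of the tessellation incident both to a cell in $A_n$ and to a cell in $\mathcal L\cap[-n,n]^3$) to a vertex on the exterior boundary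 of $A_n$ (a vertex incident both to a cell in $A_n$ and to a cell in $\mathcal L\setminus[-3n,3n]^3$). A vector $p\in\mathcal T$ lies in the extended phase if $\mathbb P_p(E_n)$ is bounded below by a positive constant independent of $n$. *)

(* Defs.v *)
From HB Require Import structures.
From mathcomp Require Import all_boot all_order all_algebra finmap.
From mathcomp Require Import all_classical all_reals all_analysis.
From mathcomp Require Import measurable_realfun.

Set Implicit Arguments.
Unset Strict Implicit.
Unset Printing Implicit Defensive.

Import Order.TTheory GRing.Theory Num.Theory.
Import numFieldNormedType.Exports.

Local Open Scope classical_set_scope.
Local Open Scope ring_scope.

#[short(type="pointedFinType")]
HB.structure Definition PointedFinite := {C of Finite C & Pointed C}.


HB.saturate bool.

HB.instance Definition _ (n : nat) := isPointed.Build 'I_n.+1 ord0.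

Section Configurations.
Variables (I : countType) (C : pointedFinType).

Definition coordinate_events : set (set (I -> C)) :=
  [set A | exists i a, A = [set c | c i = a]].

(* I -> C with the product sigma-algebra. *)
Definition config := g_sigma_algebraType coordinate_events.

Definition is_pmf (R : realType) (w : C -> R) :=
  (forall a, 0 <= w a) /\ \sum_a w a = 1.

Definition iid_law (R : realType) (w : C -> R) (mu : probability config R) :=
  forall (J : {fset I}) (a : I -> C),
    mu [set c | forall i, i \in J -> c i = a i] = (\prod_(i <- J) w (a i))%:E.

End Configurations.

(* Existence of the product law: the coordinates are read off the successive
   digits, in a numeration system with digit frequencies w, of a uniform point
   of [0, 1[. *)
Section Digits.
Variables (R : realType) (C : pointedFinType) (w : C -> R).
Hypotheses (w_ge0 : forall a, 0 <= w a) (w_sum : \sum_a w a = 1).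

Let S j : R := \sum_(b <- take j (enum C)) w b.
Let cum (a : C) : R := S (index a (enum C)).

Let S_mono i j : (i <= j)%N -> S i <= S j.
Proof.
move=> ij; rewrite /S -(subnKC ij) takeD big_cat/= lerDl.
exact: sumr_ge0.
Qed.

Let S_size : S (size (enum C)) = 1.
Proof. by rewrite /S take_size -w_sum big_enum. Qed.

Let S_index a : S (index a (enum C)).+1 = cum a + w a.
Proof.
rewrite /cum /S (take_nth a); last by rewrite index_mem mem_enum.
by rewrite big_rcons/= nth_index ?mem_enum// addrC.
Qed.

Let piece (a : C) : set R := [set u | cum a <= u < cum a + w a].

Let piece_cover u : 0 <= u < 1 -> exists a, piece a u.
Proof.
move=> /andP[u0 u1].
have ex : exists j, u < S j by exists (size (enum C)); rewrite S_size.
case: (ex_minnP ex) => -[|j] uj jmin.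
  by move: uj; rewrite /S take0 big_nil ltNge u0.
have Sju : S j <= u by rewrite leNgt; apply/negP => /jmin; rewrite ltnn.
have jlt : (j < size (enum C))%N.
  rewrite ltnNge; apply/negP => sj.
  by move: (S_mono sj); rewrite S_size leNgt (le_lt_trans Sju u1).
exists (nth point (enum C) j); rewrite /piece/= -S_index /cum index_uniq ?enum_uniq//.
by rewrite Sju.
Qed.

Let piece_inj u a b : piece a u -> piece b u -> a = b.
Proof.
wlog ab : a b / (index a (enum C) <= index b (enum C))%N.
  move=> H pa pb; have [ab|/ltnW ba] := leqP (index a (enum C)) (index b (enum C)).
    exact: H.
  by apply/esym; exact: H.
rewrite /piece/= => /andP[_ ua] /andP[ub _].
move: ab; rewrite leq_eqVlt => /predU1P[|ab].
  by move/(congr1 (nth a (enum C))); rewrite !nth_index ?mem_enum.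
by move: (S_mono ab); rewrite S_index => /le_trans/(_ ub); rewrite leNgt ua.
Qed.

Let cum_ge0 a : 0 <= cum a. Proof. exact: sumr_ge0. Qed.

Let cum_le1 a : cum a + w a <= 1.
Proof. by rewrite -S_index -S_size; apply: S_mono; rewrite index_mem mem_enum. Qed.

Let digit (u : R) : C := get (fun a => piece a u).

Let digitE u a : piece a u -> digit u = a.
Proof. by move=> pa; apply: get_unique => // b pb; exact: piece_inj pb pa. Qed.

Let digitP u a : 0 <= u < 1 -> (digit u = a <-> piece a u).
Proof.
move=> u01; split => [<-|]; last exact: digitE.
exact: (@getPex _ (fun a => piece a u)) (piece_cover u01).
Qed.

Let shift (u : R) : R := (u - cum (digit u)) / w (digit u).
Let X (n : nat) (u : R) : C := digit (iter n shift u).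

Local Fixpoint lo (s : seq C) : R :=
  if s is a :: s' then cum a + w a * lo s' else 0.
Let W (s : seq C) : R := \prod_(a <- s) w a.

Let W_ge0 s : 0 <= W s. Proof. by apply: prodr_ge0. Qed.

Let lo_bound s : 0 <= lo s /\ lo s + W s <= 1.
Proof.
elim: s => [|a s [IH1 IH2]]; first by rewrite /W big_nil/= add0r.
split; first by rewrite /= addr_ge0 ?mulr_ge0.
rewrite /W big_cons/= -/(W s) -addrA -mulrDr (le_trans _ (cum_le1 a))//.
by rewrite lerD2l ler_piMr.
Qed.

Let cylE (s : seq C) (u : R) :
  (0 <= u < 1 /\ forall i, (i < size s)%N -> X i u = nth point s i) <->
  lo s <= u < lo s + W s.
Proof.
elim: s u => [|a s IH] u.
  by rewrite /= /W big_nil add0r; split => [[]//|u01]; split.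
have [lo0 lo1] := lo_bound s.
rewrite /W big_cons/= -/(W s) -addrA -mulrDr.
have step : 0 < w a -> digit u = a ->
    lo s <= shift u < lo s + W s <->
    cum a + w a * lo s <= u < cum a + w a * (lo s + W s).
  move=> wa da; rewrite /shift da ler_pdivlMr// ltr_pdivrMr// lerBrDl ltrBlDl.
  by rewrite ![_ * w a]mulrC.
have tailE : (forall i, (i < (size s).+1)%N -> X i u = nth point (a :: s) i) <->
    digit u = a /\ forall i, (i < size s)%N -> X i (shift u) = nth point s i.
  split => [H|[H0 H] [|i] //=].
    split; first exact: (H 0%N).
    by move=> i si; have := H i.+1 si; rewrite /X iterSr.
  by rewrite ltnS => si; rewrite -H// /X iterSr.
split.
  move=> [u01 /tailE[da H]]; have pa := (digitP a u01).1 da.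
  have wa : 0 < w a.
    by move: pa => /andP[p1 p2]; move: (le_lt_trans p1 p2); rewrite ltrDl.
  apply/step => //; apply/IH; split => //.
  move: pa => /andP[p1 p2].
  by rewrite /shift da divr_ge0 ?subr_ge0//= ltr_pdivrMr// mul1r ltrBlDl.
move=> H; move: (H) => /andP[p1 p2].
have wa : 0 < w a.
  rewrite lt_neqAle w_ge0 andbT; apply/eqP => wa0; move: (le_lt_trans p1 p2).
  by rewrite -wa0 !mul0r ltxx.
have pa : piece a u.
  apply/andP; split; first by apply: le_trans p1; rewrite lerDl mulr_ge0.
  by apply: (lt_le_trans p2); rewrite lerD2l ler_piMr.
have da := digitE pa.
have [s01 Hs] := (IH (shift u)).2 ((step wa da).2 H).
split; last by apply/tailE.
move: pa => /andP[q1 q2].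
by rewrite (le_trans _ q1)//= (lt_le_trans q2).
Qed.

Local Notation U := (uniform_prob (@ltr01 R)).

Let measurable_piece a : measurable (piece a).
Proof.
rewrite (_ : piece a = `[cum a, cum a + w a[%classic); first exact: measurable_itv.
by apply/seteqP; split => u /=; rewrite in_itv/=.
Qed.

Let measurable_digit a : measurable [set u | digit u = a].
Proof.
have mN : measurable (~` \bigcup_b (piece b)).
  apply: measurableC; apply: fin_bigcup_measurable => //; exact: finite_finset.
rewrite (_ : [set u | digit u = a] = piece a `|`
  (if a == point then ~` \bigcup_b piece b else set0)).
  by apply: measurableU => //; case: ifP.
apply/seteqP; split => u /=.
  move=> da; have [[b pb]|H] := pselect (exists b, piece b u).
    by left; rewrite -da (digitE pb).
  right; rewrite -da /digit getPN; last by move=> b pb; apply: H; exists b.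
  by rewrite eqxx => -[b _ pb]; apply: H; exists b.
move=> [/digitE//|]; case: ifP => // /eqP -> H.
by apply: getPN => b pb; apply: H; exists b.
Qed.

Let measurable_shift : measurable_fun setT shift.
Proof.
move=> _ B mB; rewrite setTI.
rewrite (_ : _ @^-1` _ = \bigcup_a ([set u | digit u = a] `&`
  (fun u => (u - cum a) / w a) @^-1` B)).
  apply: fin_bigcup_measurable => [|a _]; first exact: finite_finset.
  apply: measurableI => //; rewrite -[X in measurable X]setTI.
  suff : measurable_fun setT (fun u : R => (u - cum a) / w a) by apply.
  by apply: measurable_funM => //; apply: measurable_funB.
apply/seteqP; split => u /=; first by move=> H; exists (digit u).
by move=> [a _ [/= da]]; rewrite /shift da.
Qed.

Let measurable_X n a : measurable [set u | X n u = a].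
Proof.
have mi : measurable_fun setT (iter n shift).
  elim: n => [|n IH]; first exact: measurable_id.
  exact: (measurableT_comp measurable_shift IH).
rewrite (_ : [set u | _] = setT `&` iter n shift @^-1` [set u | digit u = a]).
  exact: mi.
by rewrite setTI.
Qed.


Let U_itv (a b : R) : 0 <= a -> a <= b -> b <= 1 ->
  U [set u | a <= u < b] = (b - a)%:E.
Proof.
move=> a0 ab b1.
rewrite (_ : [set u | _] = `[a, b[%classic); last first.
  by apply/seteqP; split => u /=; rewrite in_itv/=.
rewrite /uniform_prob (eq_integral (fun=> 1%:E)); last first.
  move=> u; rewrite inE/= in_itv/= /uniform_pdf subr0 invr1 => /andP[au ub].
  by rewrite (le_trans a0 au) (ltW (lt_le_trans ub b1)).
rewrite integral_cst//= mul1e lebesgue_measure_itv/= lte_fin.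
by case: ltgtP ab => // -> _; rewrite subrr.
Qed.

Let U_out : U (~` [set u | 0 <= u < 1]) = 0%E.
Proof.
have U1 : U [set u | 0 <= u < 1] = 1%E by rewrite U_itv// subr0.
rewrite probability_setC; first by rewrite [X in (1 - X)%E]U1 subee.
rewrite (_ : [set u | _] = `[0 : R, 1[%classic); first exact: measurable_itv.
by apply/seteqP; split => u /=; rewrite in_itv/=.
Qed.

Variable (I : countType).

Let F (u : R) : config I C := fun i => X (choice.pickle i) u.

Let mF : measurable_fun [set: R] (F : R -> config I C).
Proof.
apply: (@measurability _ _ R (config I C) _ _ (@coordinate_events I C)) => //.
move=> _ [_ [i [a ->]] <-]; rewrite setTI.
exact: measurable_X.
Qed.

Let block N (f : {ffun 'I_N -> C}) : seq C := [seq f i | i <- enum 'I_N].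
Let A N (f : {ffun 'I_N -> C}) : set R :=
  [set u | lo (block f) <= u < lo (block f) + W (block f)].

Let AE N (f : {ffun 'I_N -> C}) u :
  A f u <-> 0 <= u < 1 /\ forall i : 'I_N, X i u = f i.
Proof.
rewrite /A/= -cylE size_map size_enum_ord; split => -[u01 H]; split => //.
  move=> i; rewrite H// (nth_map i) ?size_enum_ord//.
  by rewrite nth_ord_enum.
move=> i iN; rewrite (H (Ordinal iN)) (nth_map (Ordinal iN)) ?size_enum_ord//.
by congr (f _); apply: val_inj; rewrite /= nth_enum_ord.
Qed.

Let mA N (f : {ffun 'I_N -> C}) : measurable (A f).
Proof.
rewrite (_ : A f = `[lo (block f), lo (block f) + W (block f)[%classic).
  exact: measurable_itv.
by apply/seteqP; split => u /=; rewrite in_itv/=.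
Qed.

Let UA N (f : {ffun 'I_N -> C}) : U (A f) = (\prod_i w (f i))%:E.
Proof.
have [l0 l1] := lo_bound (block f).
rewrite U_itv ?lerDl// addrAC subrr add0r /W /block big_map.
by rewrite big_enum.
Qed.

Let tA N : trivIset setT (@A N).
Proof.
move=> f g _ _ [u [/AE[_ Hf] /AE[_ Hg]]].
by apply/ffunP => i; rewrite -Hf -Hg.
Qed.

Lemma digits_law : exists mu : probability (config I C) R, iid_law w mu.
Proof.
pose F' : g_sigma_algebraType R.-ocitv.-measurable -> config I C := F.
have mF' : measurable_fun setT F' by exact: mF.
pose F_mf := isMeasurableFun.Build _ _ _ _ F' mF'.
pose G : {mfun _ >-> _} := HB.pack F' F_mf.
exists (distribution U G) => J a.
pose E := F @^-1` [set c : config I C | forall i, i \in J -> c i = a i].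
change (U E = (\prod_(i <- J) w (a i))%:E).
have EE : E = [set u | forall i, i \in J -> X (choice.pickle i) u = a i] by [].
have [N JN] : exists N, forall i, i \in J -> (choice.pickle i < N)%N.
  exists (\max_(i <- J) choice.pickle i).+1 => i iJ.
  by rewrite ltnS (big_rem i)//= leq_maxl.
pose Q (k : nat) : pred C :=
  fun c => all (fun i => (choice.pickle i == k) ==> (c == a i)) J.
pose D := [set f : {ffun 'I_N -> C} | f \in family (fun k : 'I_N => Q k)].
have E01 : E `&` [set u | 0 <= u < 1] = \bigcup_(f in D) A f.
  rewrite EE; apply/seteqP; split => u /=.
    move=> [H u01]; exists [ffun k : 'I_N => X k u]; last first.
      by apply/AE; split => // i; rewrite ffunE.
    apply/familyP => k; rewrite ffunE; apply/allP => i iJ.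
    by apply/implyP => /eqP <-; rewrite H.
  move=> [f fD /AE[u01 Hf]]; split => // i iJ.
  rewrite (Hf (Ordinal (JN i iJ))).
  have /familyP/(_ (Ordinal (JN i iJ)))/allP/(_ i iJ)/= := fD.
  by rewrite eqxx => /eqP.
have finD : finite_set D by exact: finite_finset.
have mE01 : measurable (E `&` [set u | 0 <= u < 1]).
  by rewrite E01; exact: fin_bigcup_measurable.
have mE : measurable E.
  rewrite -[E]setTI; apply: mF => //.
  rewrite (_ : [set c | _] = \bigcap_(i in [set` J]) [set c : config I C | c i = a i]).
    apply: fin_bigcap_measurable => // i _; apply: sub_sigma_algebra.
    by exists i, (a i).
  by apply/seteqP; split => c /= H i; exact: H.
have m01 : measurable [set u : R | 0 <= u < 1].
  rewrite (_ : [set u | _] = `[0 : R, 1[%classic); first exact: measurable_itv.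
  by apply/seteqP; split => u /=; rewrite in_itv/=.
have -> : U E = U (E `&` [set u | 0 <= u < 1]).
  have mD : measurable (E `\` [set u | 0 <= u < 1]) by exact: measurableD.
  have mC : measurable (~` [set u : R | 0 <= u < 1]) by exact: measurableC.
  have sub : E `\` [set u | 0 <= u < 1] `<=` ~` [set u | 0 <= u < 1] by move=> u [].
  have D0 : U (E `\` [set u | 0 <= u < 1]) = 0%E.
    refine (@subset_measure0 _ _ _ U _ _ mD mC sub U_out).
  rewrite -{1}(setUIDK E [set u | 0 <= u < 1]) measureU//=; first by rewrite D0 adde0.
  by apply/seteqP; split => u // [[_ ?] [_]].
rewrite E01 measure_fin_bigcup//; last 2 first.
- by move=> f g _ _; exact: tA.
- by move=> f _; exact: mA.
rewrite (eq_fsbigr (fun f : {ffun 'I_N -> C} => (\prod_i w (f i))%:E)); last first.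
  by move=> f _; exact: UA.
rewrite (fsbigE (enum (family (fun k : 'I_N => Q k)))) ?enum_uniq//; last 2 first.
- by move=> f /=; rewrite mem_enum.
- by move=> f fD; rewrite mem_enum => /negP.
rewrite big_seq_cond (eq_bigl (fun f => f \in enum (family (fun k : 'I_N => Q k)))); last first.
  by move=> f; rewrite mem_enum mem_setE andbb.
rewrite -big_seq sumEFin big_enum/=; congr EFin.
rewrite -(bigA_distr_big_dep (fun k : 'I_N => Q k) (fun _ => w)).
pose g k := \sum_(c | Q k c) w c.
rewrite -(big_mkord xpredT g).
have gJ i : i \in J -> g (choice.pickle i) = w (a i).
  move=> iJ; rewrite /g (eq_bigl (pred1 (a i))) ?big_pred1_eq// => c.
  apply/allP/eqP => [/(_ i iJ)/=|-> j jJ]; first by rewrite eqxx => /eqP.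
  by apply/implyP => /eqP/(pcan_inj choice.pickleK) ->.
have gN k : k \notin [seq choice.pickle i | i <- J] -> g k = 1.
  move=> kJ; rewrite /g (eq_bigl xpredT)// => c; apply/allP => i iJ.
  by apply/implyP => /eqP ik; case/negP: kJ; rewrite -ik map_f.
rewrite (bigID (fun k => k \in [seq choice.pickle i | i <- J]))/=.
rewrite [X in _ * X]big1// mulr1 -big_filter.
rewrite (perm_big [seq choice.pickle i | i <- J])/=; last first.
  apply: uniq_perm; rewrite ?filter_uniq ?iota_uniq ?map_inj_uniq ?fset_uniq//.
  move=> k; rewrite mem_filter mem_index_iota/=; case: mapP => //= -[i iJ ->].
  exact: JN.
by rewrite big_map; apply: eq_big_seq => i iJ; exact: gJ.
Qed.

End Digits.

Section IidLaw.
Variables (R : realType) (I : countType) (C : pointedFinType) (w : C -> R).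

Lemma iid_law_exists :
  exists mu : probability (config I C) R, is_pmf w -> iid_law w mu.
Proof.
have [[w0 w1]|nw] := pselect (is_pmf w); last by exists (dirac point).
by have [mu mulaw] := digits_law w0 w1 I; exists mu.
Qed.

(* The law of independent coordinates with common weights w; it is meaningful
   only for w satisfying is_pmf. *)
Definition iid : probability (config I C) R := projT1 (cid iid_law_exists).

Lemma iidP : is_pmf w -> iid_law w iid.
Proof. exact: (projT2 (cid iid_law_exists)). Qed.

End IidLaw.

Definition bcc (v : 'rV[int]_3) : bool :=
  [forall i, (2 %| v ord0 i)%Z] || [forall i, (2 %| v ord0 i - 1)%Z].

(* Cells are represented by their centers. *)
Definition cell := {v : 'rV[int]_3 | bcc v}.
HB.instance Definition _ := Countable.on cell.

Definition center (v : cell) : 'rV[int]_3 := sval v.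

Definition adjacent (v w : cell) : bool :=
  let d := center v - center w in
  [exists i, (d == delta_mx ord0 i *+ 2) || (d == - (delta_mx ord0 i *+ 2))]
  || [forall i, (d ord0 i == 1) || (d ord0 i == - 1)].

Lemma bcc0 : bcc 0.
Proof. by apply/orP; left; apply/forallP => i; rewrite mxE dvdz0. Qed.

Definition origin : cell := exist _ 0 bcc0.

Section CriticalProbability.
Variable R : realType.

Definition site_weight (q : R) (b : bool) : R := if b then q else 1 - q.

Definition open_cluster (c : config cell bool) (v : cell) : set cell :=
  [set w | exists s : seq cell,
     [/\ path adjacent v s, last v s = w & all c (v :: s)]].

(* sup {q | theta(q) = 0}, where theta(q) is the probability that the open
   cluster of the origin is infinite. *)
Definition p_c : R := sup [set q : R | 0 <= q <= 1 /\
  iid cell (site_weight q) [set c | infinite_set (open_cluster c origin)] = 0%E].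

End CriticalProbability.

Definition mutually_adjacent (k : nat) (S : {fset cell}) :=
  #|` S| = k /\ {in S &, forall v w, v != w -> adjacent v w}.

(* Edges and vertices of the tessellation are represented by the sets of the
   cells incident to them. *)
Definition is_edge := mutually_adjacent 3.
Definition is_vertex := mutually_adjacent 4.

(* Red, yellow and blue are 0, 1 and 2. *)
Definition color := 'I_3.

Definition coloring := config cell color.

Definition tricolor_edge (c : coloring) (e : {fset cell}) :=
  is_edge e /\ {in e &, injective c}.

(* x and y are the two endpoints of a tricolor edge. *)
Definition tricolor_step (c : coloring) : rel {fset cell} := fun x y =>
  `[< [/\ is_vertex x, is_vertex y, x != y &
      exists e, [/\ tricolor_edge c e, (e `<=` x)%fset & (e `<=` y)%fset]] >].

Definition cube (k : nat) : set cell :=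
  [set v | forall i, `|center v ord0 i| <= k%:Z].

Definition annulus (n : nat) : set cell := cube (3 * n) `\` cube n.

Definition incident_to (x : {fset cell}) (A : set cell) :=
  exists2 v, v \in x & A v.

Definition interior_boundary (n : nat) : set {fset cell} :=
  [set x | [/\ is_vertex x, incident_to x (annulus n) &
               incident_to x (cube n)]].

Definition exterior_boundary (n : nat) : set {fset cell} :=
  [set x | [/\ is_vertex x, incident_to x (annulus n) &
               incident_to x (~` cube (3 * n))]].

Definition crossing (n : nat) : set coloring :=
  [set c | exists x s, [/\ interior_boundary n x, path (tricolor_step c) x s &
                           exterior_boundary n (last x s)]].

Section Phase.
Variable R : realType.

Definition color_simplex : set 'rV[R]_3 :=
  [set p | (forall i, 0 <= p ord0 i <= 1) /\ \sum_i p ord0 i = 1].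

Definition coloring_law (p : 'rV[R]_3) : probability coloring R :=
  iid cell (fun a : color => p ord0 a).

Definition extended_phase : set 'rV[R]_3 :=
  [set p | color_simplex p /\ exists2 eps : R, 0 < eps &
     forall n : nat, (1 <= n)%N -> (eps%:E <= coloring_law p (crossing n))%E].

Definition critical_line (i : color) : set 'rV[R]_3 :=
  [set p | color_simplex p /\ p ord0 i = p_c R].

(* The boundary of A relative to the closed set color_simplex, which has empty
   interior in R^3. *)
Definition simplex_boundary (A : set 'rV[R]_3) : set 'rV[R]_3 :=
  closure A `&` closure (color_simplex `\` A).

(* The norm on 'rV[R]_3 is the sup norm, which is equivalent to the Euclidean
   norm; the distance to the empty set is +oo. *)
Definition set_distance (A B : set 'rV[R]_3) : \bar R :=
  ereal_inf [set (`|x - y|)%:E | x in A & y in B].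

End Phase.

Arguments p_c R : clear implicits.
Arguments extended_phase R : clear implicits.
Arguments critical_line R i : clear implicits.

(* Main.v *)
(* Every tricolor path is accompanied by a chain of cells of color i (red), each
   with a neighbor of color k, where k is the rarer of the other two colors.
   Given that it is not red, a cell has color k with probability g <= 1/2. Hence
   the red cells of the chain lie in the intersection of two independent random
   sets: a Bernoulli(p_i) set, and the set of cells with a neighbor in a
   Bernoulli(g) set. The latter is dominated by a Bernoulli(tau) set for some
   tau < 1 depending only on the degree: replace, one marked cell at a time, the
   whole neighborhood of the cell, taken with probability g, by its independent
   thinning of density t, where g <= t ^+ degree. So E_n forces a crossing in
   Bernoulli site percolation of density p_i * tau. When p_i * tau < p_c, crossing
   probabilities decay exponentially by the argument of Duminil-Copin and Tassion.
   The extended phase is therefore contained in {p_i * tau >= p_c}, and p_c > 0. *)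
From Pilot Require Import Defs.
From mathcomp Require Import all_boot all_order all_algebra finmap.
From mathcomp Require Import all_classical all_reals all_analysis.
From mathcomp Require Import ring lra zify.

Set Implicit Arguments.
Unset Strict Implicit.
Unset Printing Implicit Defensive.

Import Order.TTheory GRing.Theory Num.Theory.
Import numFieldNormedType.Exports.
(* Again, since the libraries above shadow Defs.center and Defs.adjacent. *)
Import Pilot.Defs.

Local Open Scope classical_set_scope.
Local Open Scope ring_scope.

(** * Finite-volume expectations *)

(** Whether a cell of color i has a neighbor of color k is not independent from cell to cell,
    because cells share neighbors; domination restores independence at the price of a density tau <
    1. Choosing for k the rarer color gives g <= 1/2 for every p, so one value of t with t ^+ degree
    >= 1/2 serves for all p and the gap is uniform. A cell avoids the thinnings made around its at
    most [degree] neighbors with probability at least (1 - t) ^+ degree, whence tau = 1 - (1 - t) ^+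
    degree. Exponential decay is what beats the union bound over the polynomially many cells where a
    crossing may start; absence of an infinite cluster alone would not. Finally p_i * tau >= p_c
    yields p_i - p_c >= p_c * (1 - tau), which is positive because p_c > 0. The estimates are made
    on the finite sums [expect], free of measurability conditions; the product measure enters
    through cylinder events and countable combinations of them. *)

Definition upd (V : eqType) (C : Type) (c : V -> C) (v : V) (a : C) : V -> C :=
  fun x => if x == v then a else c x.

Definition determined (V C T : Type) (Q : pred V) (F : (V -> C) -> T) :=
  forall c c', (forall x, Q x -> c x = c' x) -> F c = F c'.

Lemma upd_comm (V : eqType) (C : Type) (c : V -> C) u v a b :
  u != v -> upd (upd c u a) v b = upd (upd c v b) u a.
Proof.
move=> uv; apply/funext => x; rewrite /upd.
by case: eqVneq => [->|//]; case: eqVneq => // vu; rewrite vu eqxx in uv.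
Qed.

Lemma upd_same (V : eqType) (C : Type) (c : V -> C) v a b :
  upd (upd c v a) v b = upd c v b.
Proof. by apply/funext => x; rewrite /upd; case: eqVneq. Qed.

Lemma upd_id (V : eqType) (C : Type) (c : V -> C) v : upd c v (c v) = c.
Proof. by apply/funext => x; rewrite /upd; case: eqVneq => // ->. Qed.

Section Expectation.
Variables (R : realType) (V : eqType) (C : finType).
Implicit Types (s : seq V) (w : V -> C -> R) (F G : (V -> C) -> R) (c : V -> C).

Definition stochastic w :=
  forall v, (forall a, 0 <= w v a) /\ \sum_a w v a = 1.

(* The expectation of F when the sites in s are resampled independently, with
   weights w, and all other sites are as in c. *)
Fixpoint expect w s F c : R :=
  if s is v :: s' then \sum_a w v a * expect w s' F (upd c v a) else F c.

Lemma eq_expect w s F G c : F =1 G -> expect w s F c = expect w s G c.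
Proof. by move=> /funext ->. Qed.

Lemma eq_expect_weight w w' s F c : {in s, forall v, w v =1 w' v} ->
  expect w s F c = expect w' s F c.
Proof.
elim: s c => //= v s IH c ww'; apply: eq_bigr => a _.
rewrite ww' ?mem_head// IH// => u us; apply: ww'.
by rewrite in_cons us orbT.
Qed.

Lemma expect_sum w s (I : Type) (r : seq I) (P : pred I)
    (F : I -> (V -> C) -> R) c :
  expect w s (fun c' => \sum_(i <- r | P i) F i c') c =
  \sum_(i <- r | P i) expect w s (F i) c.
Proof.
elim: s c => //= v s IH c; rewrite exchange_big/=.
by apply: eq_bigr => a _; rewrite IH mulr_sumr.
Qed.

Lemma expectD w s F G c :
  expect w s (fun c' => F c' + G c') c = expect w s F c + expect w s G c.
Proof.
elim: s c => //= v s IH c; rewrite -big_split/=.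
by apply: eq_bigr => a _; rewrite IH mulrDr.
Qed.

Lemma expectZ w s k F c :
  expect w s (fun c' => k * F c') c = k * expect w s F c.
Proof.
elim: s c => //= v s IH c; rewrite mulr_sumr.
by apply: eq_bigr => a _; rewrite IH mulrCA.
Qed.

Lemma expectN w s F c : expect w s (fun c' => - F c') c = - expect w s F c.
Proof.
rewrite -mulN1r -expectZ; apply: eq_expect => c'.
by rewrite mulN1r.
Qed.

Lemma le_expect w s F G c : stochastic w -> (forall c', F c' <= G c') ->
  expect w s F c <= expect w s G c.
Proof.
move=> w_st FG; elim: s c => //= v s IH c; apply: ler_sum => a _.
by rewrite ler_wpM2l// (w_st v).1.
Qed.

Lemma expect_cst w s k c : stochastic w -> expect w s (fun=> k) c = k.
Proof.
move=> w_st; elim: s c => //= v s IH c.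
by under eq_bigr do rewrite IH; rewrite -mulr_suml (w_st v).2 mul1r.
Qed.

(** For distinct sites this is an exchange of sums; at a common site the later value overwrites the
    earlier one. *)
Lemma expect_swap w s s' F c :
  expect w s (expect w s' F) c = expect w s' (expect w s F) c.
Proof.
have swap1 u F' c' :
    expect w [:: u] (expect w s' F') c' = expect w s' (expect w [:: u] F') c'.
  elim: s' c' => //= v s' IH c'.
  have [->|uv] := eqVneq v u.
    apply: eq_bigr => a _; congr (_ * _).
    by rewrite -IH; apply: eq_bigr => b _; rewrite !upd_same.
  transitivity (\sum_a \sum_b w u a * (w v b * expect w s' F' (upd (upd c' u a) v b))).
    by apply: eq_bigr => a _; rewrite mulr_sumr.
  rewrite exchange_big/=; apply: eq_bigr => b _; rewrite -IH mulr_sumr.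
  by apply: eq_bigr => a _; rewrite upd_comm 1?eq_sym// mulrCA.
elim: s c => //= u s IH c; have := swap1 u (expect w s F) c.
by rewrite /= => <-; apply: eq_bigr => a _; rewrite IH.
Qed.

Lemma expect_determined w s F (Q : pred V) : determined Q F ->
  determined [pred x | Q x & x \notin s] (expect w s F).
Proof.
move=> QF; elim: s => [|v s IH] c c' cc' /=.
  by apply: QF => x Qx; apply: cc'; rewrite /= Qx.
apply: eq_bigr => a _; congr (_ * _); apply: IH => x /andP[Qx xs].
rewrite /upd; case: eqVneq => // xv; apply: cc'.
by rewrite /= Qx in_cons negb_or xv.
Qed.

(** Resample both lists: averaging over either one already yields a constant, which the other
    averaging preserves. *)
Lemma expect_support w s s' F c c' (Q : pred V) : stochastic w ->
  determined Q F -> {subset Q <= s} -> {subset Q <= s'} ->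
  expect w s F c = expect w s' F c'.
Proof.
move=> w_st QF Qs Qs'.
have const t c1 c2 : {subset Q <= t} -> expect w t F c1 = expect w t F c2.
  move=> Qt; apply: (expect_determined w (s := t) QF) => x /andP[/Qt xt].
  by rewrite /= xt.
transitivity (expect w s' (expect w s F) c); last first.
  by rewrite expect_swap (eq_expect _ _ _ (fun d => const s' d c' Qs')) expect_cst.
by rewrite (eq_expect _ _ _ (fun d => const s d c Qs)) expect_cst.
Qed.

Lemma expect_upd w s F c v a : v \notin s ->
  expect w s (fun c' => F (upd c' v a)) c = expect w s F (upd c v a).
Proof.
elim: s c => //= u s IH c; rewrite in_cons negb_or => /andP[vu vs].
by apply: eq_bigr => b _; rewrite IH// upd_comm 1?eq_sym.
Qed.

(** Each site is read by at most one of the two functions, so its average passes through the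
    other. *)
Lemma expectM w s F G c (Q : pred V) : stochastic w ->
  determined Q F -> determined (predC Q) G ->
  expect w s (fun c' => F c' * G c') c = expect w s F c * expect w s G c.
Proof.
move=> w_st QF QG; elim: s c => //= v s IH c.
have [Qv|Qv] := boolP (Q v).
  have Gv a : expect w s G (upd c v a) = expect w s G c.
    apply: (expect_determined w (s := s) QG) => x /andP[/= Qx _]; rewrite /upd.
    by case: eqVneq Qx => // ->; rewrite Qv.
  under eq_bigr do rewrite IH Gv mulrA.
  rewrite -mulr_suml; congr (_ * _).
  by under eq_bigr do rewrite Gv; rewrite -mulr_suml (w_st v).2 mul1r.
have Fv a : expect w s F (upd c v a) = expect w s F c.
  apply: (expect_determined w (s := s) QF) => x /andP[/= Qx _]; rewrite /upd.
  by case: eqVneq Qx Qv => // -> ->.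
under eq_bigr do rewrite IH Fv mulrCA.
rewrite -mulr_sumr; congr (_ * _).
by under eq_bigr do rewrite Fv; rewrite -mulr_suml (w_st v).2 mul1r.
Qed.

(* The spatial Markov property: if the event X = k is determined by the sites
   in Q k, and f k by the other ones, then f X can be computed from X and an
   independent copy of the configuration. *)
Lemma expect_markov w s (T : choiceType) (X : (V -> C) -> T) (L : {fset T})
    (Q : T -> pred V) (f : T -> (V -> C) -> R) c0 :
  stochastic w -> (forall c, X c \in L) ->
  (forall k, determined (Q k) (fun c => X c == k)) ->
  (forall k, k \in L -> determined (predC (Q k)) (f k)) ->
  expect w s (fun c => f (X c) c) c0 =
  expect w s (fun c => expect w s (f (X c)) c0) c0.
Proof.
move=> w_st XL XQ fQ.
(* Decompose over the finitely many values of [X]; each term is then a product of functions of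
   disjoint sets of sites. *)
have split (g : T -> (V -> C) -> R) c :
    g (X c) c = \sum_(k <- L) (X c == k)%:R * g k c.
  rewrite (big_fsetD1 (X c))//= eqxx mul1r big_seq big1 ?addr0// => k.
  by rewrite in_fsetD1 eq_sym => /andP[/negPf -> _]; rewrite mul0r.
rewrite (eq_expect _ _ _ (split f)).
rewrite (eq_expect _ _ _ (split (fun k _ => expect w s (f k) c0))) !expect_sum.
apply: eq_big_seq => k kL; rewrite (expectM _ _ w_st (Q := Q k)).
- rewrite [LHS]mulrC -expectZ; apply: eq_expect => c; exact: mulrC.
- by move=> c c' cc'; rewrite (XQ k _ _ cc').
- exact: fQ.
Qed.

End Expectation.

(** * Changes of variables in finite expectations *)

Section Pushforward.
Variable R : realType.

(** Used to generate colors from independent bits, and to identify the law of a conjunction or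
    disjunction of independent bits. *)
Lemma expect_push (V : eqType) (B C : finType) (h : V -> B -> C)
    (w : V -> C -> R) (u : V -> B -> R) (s : seq V) (F : (V -> C) -> R) c :
  (forall v, v \in s -> forall a, w v a = \sum_(b | h v b == a) u v b) ->
  expect w s F (fun v => h v (c v)) = expect u s (fun d => F (fun v => h v (d v))) c.
Proof.
elim: s c => //= v s IH c wu.
rewrite (eq_bigr (fun a => \sum_(b | h v b == a) u v b *
    expect u s (fun d => F (fun v => h v (d v))) (upd c v b))); last first.
  move=> a _; rewrite wu ?mem_head// mulr_suml; apply: eq_bigr => b /eqP hb.
  rewrite -IH => [|x xs]; last by apply: wu; rewrite in_cons xs orbT.
  congr (_ * expect _ _ _ _); apply/funext => x; rewrite /upd.
  by case: eqVneq => // ->.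
by rewrite (partition_big (h v) xpredT).
Qed.

Lemma expect_prod (V : eqType) (B C : finType) (w1 : V -> B -> R)
    (w2 : V -> C -> R) (s : seq V) (F : (V -> B * C) -> R) c1 c2 :
  expect (fun v ab => w1 v ab.1 * w2 v ab.2) s F (fun v => (c1 v, c2 v)) =
  expect w1 s (fun d1 => expect w2 s (fun d2 => F (fun v => (d1 v, d2 v))) c2) c1.
Proof.
elim: s c1 c2 F => //= v s IH c1 c2 F.
transitivity (\sum_a \sum_b w1 v a * w2 v b *
    expect (fun v ab => w1 v ab.1 * w2 v ab.2) s F
      (upd (fun v => (c1 v, c2 v)) v (a, b))).
  by rewrite pair_bigA; apply: eq_bigr => -[].
apply: eq_bigr => a _.
have E b : upd (fun v => (c1 v, c2 v)) v (a, b) =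
    (fun x => (upd c1 v a x, upd c2 v b x)).
  by apply/funext => x; rewrite /upd; case: eqVneq.
under eq_bigr do rewrite E IH.
rewrite expect_sum mulr_sumr; apply: eq_bigr => b _.
by rewrite expectZ mulrA.
Qed.

Lemma expect_map (U V : eqType) (C : finType) (f : U -> V) (g : V -> U)
    (w : V -> C -> R) (s : seq U) (F : (V -> C) -> R) c :
  cancel f g -> cancel g f ->
  expect w (map f s) F c = expect (w \o f) s (fun d => F (d \o g)) (c \o f).
Proof.
move=> fK gK; elim: s c => /= [c|u s IH c].
  by congr F; apply/funext => x /=; rewrite gK.
apply: eq_bigr => a _; rewrite IH; congr (_ * expect _ _ _ _).
by apply/funext => x; rewrite /upd/= (inj_eq (can_inj fK)).
Qed.

End Pushforward.

(** * Bernoulli configurations and stochastic domination *)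

Section Bernoulli.
Variables (R : realType) (V : eqType).
Implicit Types (s : seq V) (q : V -> R) (F : (V -> bool) -> R) (c : V -> bool).

Definition bernoulli_weight q : V -> bool -> R := fun v => site_weight (q v).

Definition increasing F :=
  forall c c', (forall x, c x ==> c' x) -> F c <= F c'.

Lemma site_weight_pmf (x : R) : 0 <= x <= 1 ->
  (forall b, 0 <= site_weight x b) /\ \sum_b site_weight x b = 1.
Proof.
move=> /andP[x0 x1]; split; last by rewrite big_bool/= addrC subrK.
by case => //=; rewrite subr_ge0.
Qed.

Lemma stochastic_bernoulli q :
  (forall v, 0 <= q v <= 1) -> stochastic (bernoulli_weight q).
Proof. by move=> q01 v; exact: site_weight_pmf. Qed.

Lemma upd_implyb c c' v b : (forall x, c x ==> c' x) ->
  forall x, upd c v b x ==> upd c' v b x.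
Proof. by move=> cc' x; rewrite /upd; case: eqVneq => // _; case: b. Qed.

Lemma expect_increasing (w : V -> bool -> R) s F :
  stochastic w -> increasing F -> increasing (expect w s F).
Proof.
move=> w_st F_incr; elim: s => //= v s IH c c' cc'; apply: ler_sum => a _.
by rewrite ler_wpM2l ?(w_st v).1// IH//; exact: upd_implyb.
Qed.

Lemma expect_bernoulli_le q q' s F c :
  (forall v, 0 <= q v <= q' v) -> (forall v, q' v <= 1) -> increasing F ->
  expect (bernoulli_weight q) s F c <= expect (bernoulli_weight q') s F c.
Proof.
move=> qq' q'1 F_incr; elim: s c => //= v s IH c; rewrite !big_bool/=.
set w := bernoulli_weight q; set w' := bernoulli_weight q'.
have w'_st : stochastic w'.
  apply: stochastic_bernoulli => x; rewrite q'1 andbT.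
  by have /andP[q0 qq] := qq' x; exact: le_trans qq.
have /andP[q0 qq] := qq' v; have q1 := q'1 v.
have Etf : expect w' s F (upd c v false) <= expect w' s F (upd c v true).
  apply: expect_increasing => // x; rewrite /upd.
  by case: eqVneq => // _; exact: implybb.
(* First change the law of the sites after [v], then that of [v] itself, where an open state gives
   the larger average. *)
apply: (@le_trans _ _ (q v * expect w' s F (upd c v true) +
    (1 - q v) * expect w' s F (upd c v false))).
  by rewrite lerD// ler_wpM2l ?IH// subr_ge0 (le_trans qq).
rewrite -subr_ge0 /w' /bernoulli_weight/=.
set B := expect _ _ _ _ in Etf *; set A := expect _ _ _ (upd c v true) in Etf *.
rewrite (_ : _ - _ = (q' v - q v) * (A - B)); last by ring.
by rewrite mulr_ge0// subr_ge0.
Qed.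

Lemma expect_andb q1 q2 s F c1 c2 :
  expect (bernoulli_weight q1) s (fun d1 => expect (bernoulli_weight q2) s
    (fun d2 => F (fun v => d1 v && d2 v)) c2) c1 =
  expect (bernoulli_weight (fun v => q1 v * q2 v)) s F (fun v => c1 v && c2 v).
Proof.
rewrite (@expect_push _ _ _ _ (fun _ (ab : bool * bool) => ab.1 && ab.2)
  (bernoulli_weight (fun v => q1 v * q2 v))
  (fun v ab => bernoulli_weight q1 v ab.1 * bernoulli_weight q2 v ab.2)
  s F (fun v => (c1 v, c2 v))).
  by rewrite expect_prod.
move=> v _ a; rewrite big_mkcond -(pair_bigA _ (fun a1 a2 =>
  if a1 && a2 == a then bernoulli_weight q1 v a1 * bernoulli_weight q2 v a2
  else 0))/= !big_bool /bernoulli_weight/=.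
by case: a => /=; rewrite ?addr0 ?add0r//; ring.
Qed.

Lemma expect_orb q1 q2 s F c1 c2 :
  expect (bernoulli_weight q1) s (fun d1 => expect (bernoulli_weight q2) s
    (fun d2 => F (fun v => d1 v || d2 v)) c2) c1 =
  expect (bernoulli_weight (fun v => 1 - (1 - q1 v) * (1 - q2 v))) s F
    (fun v => c1 v || c2 v).
Proof.
rewrite (@expect_push _ _ _ _ (fun _ (ab : bool * bool) => ab.1 || ab.2)
  (bernoulli_weight (fun v => 1 - (1 - q1 v) * (1 - q2 v)))
  (fun v ab => bernoulli_weight q1 v ab.1 * bernoulli_weight q2 v ab.2)
  s F (fun v => (c1 v, c2 v))).
  by rewrite expect_prod.
move=> v _ a; rewrite big_mkcond -(pair_bigA _ (fun a1 a2 =>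
  if a1 || a2 == a then bernoulli_weight q1 v a1 * bernoulli_weight q2 v a2
  else 0))/= !big_bool /bernoulli_weight/=.
by case: a => /=; rewrite ?addr0 ?add0r//; ring.
Qed.

(* All the sites of N are included with probability t ^+ count N s. *)
Lemma expect_thinned_ge (N : pred V) t s F c : 0 <= t <= 1 -> uniq s ->
  {in s, forall v, c v = false} -> increasing F ->
  t ^+ count N s * F (fun v => c v || (v \in s) && N v) +
    (1 - t ^+ count N s) * F c <=
  expect (bernoulli_weight (fun v => if N v then t else 0)) s F c.
Proof.
move=> /andP[t0 t1] + + F_incr.
elim: s c => [|v s IH] c /=.
  move=> _ _; rewrite expr0 subrr mul0r addr0 mul1r; apply: F_incr => x.
  by rewrite orbF implybb.
move=> /andP[vs us] cs; rewrite big_bool /bernoulli_weight/=.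
have cv : upd c v false = c by rewrite -(cs v (mem_head _ _)) upd_id.
have cs' : {in s, forall u, c u = false}.
  by move=> u us'; apply: cs; rewrite in_cons us' orbT.
case: (boolP (N v)) => Nv; last first.
  rewrite mul0r add0r subr0 mul1r cv add0n.
  rewrite (_ : (fun _ => _) = fun u => c u || (u \in s) && N u); first exact: IH.
  apply/funext => u; rewrite in_cons; case: eqVneq => //= ->.
  by rewrite (negPf Nv) (negPf vs).
have cs1 : {in s, forall u, upd c v true u = false}.
  by move=> u us'; rewrite /upd; case: eqVneq us' => [->|_]; [rewrite (negPf vs)|exact: cs'].
have := IH _ us cs1; have := IH _ us cs'; rewrite cv.
rewrite (_ : (fun u => upd c v true u || _) =
  fun u => c u || (u \in v :: s) && N u); last first.
  apply/funext => u; rewrite /upd in_cons; case: eqVneq => //= ->.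
  by rewrite Nv orbT.
set E0 := expect _ _ _ c; set E1 := expect _ _ _ (upd c v true).
set A := F (fun u => c u || (u \in v :: s) && N u).
set B := F c; set B1 := F (upd _ _ _).
set A0 := F (fun u => c u || (u \in s) && N u).
have B1B : B <= B1.
  by apply: F_incr => x; rewrite /upd; case: eqVneq => _; rewrite ?implybT ?implybb.
have A0B : B <= A0 by apply: F_incr => x; case: (c x).
rewrite add1n exprS; set T := t ^+ _.
have T0 : 0 <= T by exact: exprn_ge0.
have T1 : T <= 1 by exact: exprn_ile1.
move=> h0 h1.
have h0' : B <= E0.
  apply: le_trans h0; rewrite -subr_ge0.
  rewrite (_ : _ - _ = T * (A0 - B)); last by ring.
  by rewrite mulr_ge0// subr_ge0.
have h1' : T * A + (1 - T) * B <= E1.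
  by apply: le_trans h1; rewrite lerD2l ler_wpM2l// subr_ge0.
(* If [v] is kept, use the induction hypothesis; if it is dropped, settle for the lower bound
   [B]. *)
apply: (@le_trans _ _ (t * (T * A + (1 - T) * B) + (1 - t) * B)).
  by rewrite le_eqVlt; apply/orP; left; apply/eqP; ring.
by rewrite lerD// ler_wpM2l// subr_ge0.
Qed.

(** * Domination of the neighborhood of a Bernoulli set by a Bernoulli set *)

Section Domination.
Variables (N : rel V) (s : seq V) (D : nat) (g t : R).
Hypotheses (s_uniq : uniq s) (g01 : 0 <= g <= 1) (t01 : 0 <= t <= 1).
Hypotheses (g_le : g <= t ^+ D).
Hypothesis (N_out : forall w, (count (N w) s <= D)%N).
Hypothesis (N_in : forall v, (count (N^~ v) s <= D)%N).

(** Marks are read on [l], which shrinks in the induction below, while the sites that can be hit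
    remain those of [s]. *)
Definition hit (l : seq V) (m : V -> bool) (v : V) :=
  (v \in s) && has (fun w => m w && N w v) l.

Let hit_cons w l m b v : w \notin l ->
  hit (w :: l) (upd m w b) v = (b && (v \in s) && N w v) || hit l m v.
Proof.
move=> wl; rewrite /hit/= {1}/upd eqxx.
have -> : has (fun u => upd m w b u && N u v) l = has (fun u => m u && N u v) l.
  apply: eq_in_has => u ul; rewrite /upd; case: eqVneq ul => // ->.
  by rewrite (negPf wl).
by case: (v \in s); case: b; case: (N w v).
Qed.

(** [K] holds the sites already covered, so that the neighborhood of a marked site can be absorbed
    into it when that site is removed from [l]. On the right, [v] receives one independent thinning
    of density [t] for each [w] in [l] with [N w v]. *)
Lemma expect_hit_le_gen l (F : (V -> bool) -> R) K c : uniq l -> increasing F ->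
  expect (bernoulli_weight (fun=> g)) l (fun m => F (fun v => K v || hit l m v)) c <=
  expect (bernoulli_weight (fun v => 1 - (1 - t) ^+ count (N^~ v) l)) s
    (fun k => F (fun v => K v || k v)) (fun=> false).
Proof.
have /andP[t0 t1] := t01; have /andP[g0 g1] := g01.
have pi01 l' v : 0 <= 1 - (1 - t) ^+ count (N^~ v) l' <= 1.
  rewrite subr_ge0 exprn_ile1 ?subr_ge0//; last by rewrite lerBlDr lerDl.
  by rewrite lerBlDr lerDl exprn_ge0// subr_ge0.
move=> + F_incr; elim: l K c => [|w l IH] K c /=.
  move=> _.
  rewrite -[leLHS](@expect_cst _ _ _
    (bernoulli_weight (fun v => 1 - (1 - t) ^+ 0)) s _ (fun=> false)).
    apply: le_expect => [|k]; last first.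
      by apply: F_incr => x; rewrite /hit andbF orbF; case: (K x).
    by apply: stochastic_bernoulli => v; rewrite expr0 subrr lexx ler01.
  by apply: stochastic_bernoulli => v; rewrite expr0 subrr lexx ler01.
move=> /andP[wl ul]; rewrite big_bool/= -!expect_upd//.
set pi' := fun v => 1 - (1 - t) ^+ count (N^~ v) l.
pose tau v : R := if N w v then t else 0.
have Et : expect (bernoulli_weight (fun=> g)) l
    (fun m => F (fun v => K v || hit (w :: l) (upd m w true) v)) c <=
  expect (bernoulli_weight pi') s
    (fun k => F (fun v => (K v || (v \in s) && N w v) || k v)) (fun=> false).
  rewrite (eq_expect _ _ _ (G := fun m =>
    F (fun v => (K v || (v \in s) && N w v) || hit l m v))) ?IH// => m.
  by congr F; apply/funext => v; rewrite hit_cons// orbA.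
have Ef : expect (bernoulli_weight (fun=> g)) l
    (fun m => F (fun v => K v || hit (w :: l) (upd m w false) v)) c <=
  expect (bernoulli_weight pi') s (fun k => F (fun v => K v || k v)) (fun=> false).
  rewrite (eq_expect _ _ _ (G := fun m => F (fun v => K v || hit l m v))) ?IH// => m.
  by congr F; apply/funext => v; rewrite hit_cons.
apply: (@le_trans _ _ (expect (bernoulli_weight pi') s (fun k =>
    g * F (fun v => (K v || (v \in s) && N w v) || k v) +
    (1 - g) * F (fun v => K v || k v)) (fun=> false))).
  by rewrite expectD !expectZ lerD// ler_wpM2l// subr_ge0.
(* The density for [w :: l] is that of the union of a set of density [pi'] and an independent set of
   density [tau]. *)
rewrite [leRHS](eq_expect_weight (w' := bernoulli_weight
    (fun v => 1 - (1 - pi' v) * (1 - tau v)))); last first.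
  move=> v _ b; rewrite /bernoulli_weight; congr site_weight.
  rewrite /pi' /tau subKr; case: (N w v); last by rewrite subr0 mulr1.
  by rewrite add1n exprS mulrC.
rewrite -(expect_orb pi' tau s (fun k => F (fun v => K v || k v))
  (fun=> false) (fun=> false)).
apply: le_expect => [|k]; first exact: stochastic_bernoulli (pi01 l).
set H := fun d : V -> bool => F (fun v => K v || (k v || d v)).
have H_incr : increasing H.
  move=> d d' dd'; apply: F_incr => x; apply/implyP => /orP[->//|/orP[->|]].
    by rewrite orbT.
  by have /implyP dx := dd' x; move=> /dx ->; rewrite !orbT.
(* With [k] frozen, compare taking all of [N w] with probability [g] to the thinning, which contains
   all of it with probability at least [g]. *)
have := @expect_thinned_ge (N w) t s H (fun=> false) t01 s_uniq (fun _ _ => erefl) H_incr.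
apply: le_trans; rewrite /=.
set A := H _; set B := H _.
have -> : F (fun v => (K v || (v \in s) && N w v) || k v) = A.
  by rewrite /A /H; congr F; apply/funext => v; rewrite -!orbA [k v || _]orbC.
have -> : F (fun v => K v || k v) = B.
  by rewrite /B /H; congr F; apply/funext => v; rewrite orbF.
have BA : B <= A by apply: H_incr => x; apply/implyP.
have gT : g <= t ^+ count (N w) s.
  by rewrite (le_trans g_le)// ler_wiXn2l.
rewrite -subr_ge0.
rewrite (_ : _ - _ = (t ^+ count (N w) s - g) * (A - B)); last by ring.
by rewrite mulr_ge0// subr_ge0.
Qed.

Lemma expect_hit_le (F : (V -> bool) -> R) c : increasing F ->
  expect (bernoulli_weight (fun=> g)) s (fun m => F (hit s m)) c <=
  expect (bernoulli_weight (fun=> 1 - (1 - t) ^+ D)) s F (fun=> false).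
Proof.
move=> F_incr; have := expect_hit_le_gen (fun=> false) c s_uniq F_incr.
move=> /le_trans; apply; apply: expect_bernoulli_le => // v.
  have /andP[t0 t1] := t01.
  have t'1 : 1 - t <= 1 by rewrite lerBlDr lerDl.
  rewrite subr_ge0 exprn_ile1 ?subr_ge0//= lerB// ler_wiXn2l ?subr_ge0//.
by rewrite lerBlDr lerDl exprn_ge0// subr_ge0; case/andP: t01.
Qed.

End Domination.

(** Russo's formula. The product rule at the first site gives its own increment plus the averaged
    derivatives of the two branches. *)
Lemma is_derive_expect_bernoulli s F c (x : R) : uniq s ->
  is_derive x 1 (fun y => expect (bernoulli_weight (fun=> y)) s F c)
    (\sum_(v <- s) expect (bernoulli_weight (fun=> x)) s
       (fun d => F (upd d v true) - F (upd d v false)) c).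
Proof.
elim: s c => [|v s IH] c /=; first by rewrite big_nil => _; exact: is_derive_cst.
move=> /andP[vs us].
have IH1 := IH (upd c v true) us; have IH0 := IH (upd c v false) us.
set E := fun b y => expect (bernoulli_weight (fun=> y)) s F (upd c v b) : R.
set E' := fun b => \sum_(u <- s) expect (bernoulli_weight (fun=> x)) s
       (fun d => F (upd d u true) - F (upd d u false)) (upd c v b) : R.
rewrite (_ : (fun y => _) = (fun y => y * E true y + (1 - y) * E false y)); last first.
  by apply/funext => y; rewrite big_bool.
have D1 : is_derive x 1 (E true) (E' true) by exact: IH1.
have D0 : is_derive x 1 (E false) (E' false) by exact: IH0.
rewrite (_ : (fun y => _) = (id * E true + (cst 1 - id) * E false)) //.
apply: is_derive_eq; rewrite /= big_cons.
have -> : \sum_a bernoulli_weight (fun=> x) v a *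
    expect (bernoulli_weight (fun=> x)) s
      (fun d => F (upd d v true) - F (upd d v false)) (upd c v a) =
    E true x - E false x.
  rewrite (eq_bigr (fun a => bernoulli_weight (fun=> x) v a *
    (E true x - E false x))).
    by rewrite -mulr_suml big_bool/= addrC subrK mul1r.
  move=> a _; congr (_ * _); rewrite expectD expectN.
  by rewrite !(expect_upd _ _ (upd c v a))// !upd_same.
have -> : \sum_(j <- s) \sum_a bernoulli_weight (fun=> x) v a *
    expect (bernoulli_weight (fun=> x)) s
      (fun d => F (upd d j true) - F (upd d j false)) (upd c v a) =
    x * E' true + (1 - x) * E' false.
  by rewrite exchange_big/= big_bool/= !mulr_sumr.
by rewrite /GRing.scale/= /cst (_ : ((fun=> 1) - id) x = 1 - x)//; ring.
Qed.

End Bernoulli.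

(** * Clusters and their exploration *)

Section Exploration.
Variables (V : choiceType) (adj : rel V) (nb : V -> {fset V}).
Hypotheses (adj_sym : symmetric adj) (nbP : forall x y, (y \in nb x) = adj x y).
Implicit Types (o c : V -> bool) (D L S K : {fset V}) (Z : pred V).

Definition reach o x y :=
  exists s, [/\ path adj x s, last x s = y & all o (x :: s)].

Lemma reach_refl o x : o x -> reach o x x.
Proof. by move=> ox; exists [::]; rewrite /= ox. Qed.

Lemma reach_step o x y z : reach o x y -> adj y z -> o z -> reach o x z.
Proof.
move=> [s [xs sy os]] yz oz; exists (rcons s z).
by rewrite rcons_path xs sy last_rcons -rcons_cons all_rcons oz.
Qed.

Lemma reach_head o x y z : o x -> adj x y -> reach o y z -> reach o x z.
Proof.
by move=> ox xy [s [ys sz os]]; exists (y :: s); split; rewrite //= ?xy ?ox.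
Qed.

Lemma reach_ind o (P : V -> Prop) x y : reach o x y -> (o x -> P x) ->
  (forall u v, P u -> adj u v -> o v -> P v) -> P y.
Proof.
move=> [s [+ + +]] Px Pstep.
elim: s x Px => [|z s IH] x Px /=.
  by move=> _ <-; rewrite andbT => /Px.
move=> /andP[xz zs] sy /and3P[ox oz os]; apply: (IH z) => //=.
  by move=> _; apply: Pstep xz oz; exact: Px.
by rewrite oz.
Qed.

Lemma reach_start o x y : reach o x y -> o x.
Proof. by move=> [s [_ _ /andP[]]]. Qed.

Lemma reach_end o x y : reach o x y -> o y.
Proof. by move=> oxy; apply: (reach_ind (P := o) oxy). Qed.

Lemma reach_mono o o' x y : (forall u, o u -> o' u) -> reach o x y -> reach o' x y.
Proof.
by move=> oo' [s [xs sy os]]; exists s; split => //; exact: sub_all os.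
Qed.

Lemma reach_sym o x y : reach o x y -> reach o y x.
Proof.
move=> oxy; apply: (reach_ind (P := fun u => reach o u x) oxy) => [|u v ux uv ov]; first exact: reach_refl.
by apply: reach_head ux => //; rewrite adj_sym.
Qed.

Lemma reach_trans o x y z : reach o x y -> reach o y z -> reach o x z.
Proof.
move=> xy yz; apply: (reach_ind (P := reach o x) yz) => // u v.
exact: reach_step.
Qed.

Lemma reach_first_exit o (P : pred V) x z : reach o x z -> P x ->
  reach (fun u => o u && P u) x z \/
  exists u v, [/\ reach (fun u => o u && P u) x u, adj u v & ~~ P v].
Proof.
move=> oxz Px; pose exits z := reach (fun u => o u && P u) x z \/
  exists u v, [/\ reach (fun u => o u && P u) x u, adj u v & ~~ P v].
apply: (reach_ind (P := exits) oxz) => [ox|u v]; first by left; apply: reach_refl; rewrite ox.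
move=> [xu uv ov|]; last by right.
have [Pv|Pv] := boolP (P v); last by right; exists u, v.
by left; apply: reach_step xu uv _; rewrite ov.
Qed.

Lemma reach_last_exit o (P : pred V) x z : reach o x z -> P x -> ~~ P z ->
  exists u y, [/\ P u, adj u y & reach (fun v => o v && ~~ P v) y z].
Proof.
move=> oxz + Pz; pose exits x := reach (fun v => o v && ~~ P v) x z \/
  exists u y, [/\ P u, adj u y & reach (fun v => o v && ~~ P v) y z].
have : exits x.
  move/reach_sym: oxz => ozx; apply: (reach_ind (P := exits) ozx) => [oz|u v].
    by left; apply: reach_refl; rewrite oz.
  move=> [uz uv ov|]; last by right.
  have [Pv|Pv] := boolP (P v); first by right; exists v, u; rewrite adj_sym.
  by left; apply: reach_head uz; rewrite ?ov// adj_sym.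
by move=> [/reach_start/andP[_ /negPf ->]|].
Qed.

(** Sites of [K] itself may occur here, hence the differences with [S] further on. *)
Definition bnd K : {fset V} := (\bigcup_(x <- K) nb x)%fset.

Lemma bndP K y : reflect (exists2 x, x \in K & adj x y) (y \in bnd K).
Proof.
apply: (iffP (bigfcupP _ _ _ _)) => [[x /andP[xK _]]|[x xK xy]].
  by rewrite nbP; exists x.
by exists x; rewrite ?xK ?nbP.
Qed.

(** The seeds form a predicate: [pred1 o] gives the cluster of a site, and [rim L] the cluster of
    the exterior of [L]. *)
Definition cluster D Z c : {fset V} := [fset x in D |
  `[< exists2 z, Z z & reach (fun u => c u && (u \in D)) z x >]]%fset.

(* The sites that are inspected when the cluster is found to be K. *)
Definition explored D Z K : {fset V} :=
  [fset x in D | Z x || (x \in bnd K)]%fset.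

Lemma clusterP D Z c x : reflect
  (exists2 z, Z z & reach (fun u => c u && (u \in D)) z x) (x \in cluster D Z c).
Proof.
rewrite !inE/=; apply: (iffP andP) => [[_ /asboolP//]|H].
by split; [have [z _ /reach_end/andP[]] := H|apply/asboolP].
Qed.

Lemma cluster_seed D Z c x : Z x -> x \in D -> c x -> x \in cluster D Z c.
Proof.
by move=> Zx xD cx; apply/clusterP; exists x => //; apply: reach_refl; rewrite cx.
Qed.

Lemma cluster_step D Z c x y :
  x \in cluster D Z c -> adj x y -> y \in D -> c y -> y \in cluster D Z c.
Proof.
move=> /clusterP[z Zz zx] xy yD cy; apply/clusterP; exists z => //.
by apply: reach_step zx xy _; rewrite cy.
Qed.

Lemma cluster_open D Z c x : x \in cluster D Z c -> c x.
Proof. by move=> /clusterP[z _ /reach_end/andP[]]. Qed.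

Lemma cluster_sub D Z c : (cluster D Z c `<=` D)%fset.
Proof. by apply/fsubsetP => x /clusterP[z _ /reach_end/andP[]]. Qed.

Lemma cluster_ind D Z c (P : V -> Prop) x : x \in cluster D Z c ->
  (forall z, Z z -> z \in D -> c z -> P z) ->
  (forall u v, P u -> adj u v -> v \in D -> c v -> P v) -> P x.
Proof.
move=> /clusterP[z Zz zx] P0 Pstep; apply: (reach_ind (P := P) zx) => [/andP[cz zD]|].
  exact: P0.
by move=> u v Pu uv /andP[cv vD]; exact: Pstep uv vD cv.
Qed.

Lemma cluster_mono D Z c c' x : (forall u, c u ==> c' u) ->
  x \in cluster D Z c -> x \in cluster D Z c'.
Proof.
move=> cc' xc; apply: (cluster_ind (P := fun x => x \in cluster D Z c') xc) => [z Zz zD cz|u v uc uv vD cv].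
  by apply: cluster_seed => //; exact: (implyP (cc' z)).
by apply: cluster_step uc uv vD _; exact: (implyP (cc' v)).
Qed.

Lemma explored_seed D Z K x : Z x -> x \in D -> x \in explored D Z K.
Proof. by move=> Zx xD; rewrite !inE/= xD Zx. Qed.

Lemma explored_step D Z K x y : x \in K -> adj x y -> y \in D -> y \in explored D Z K.
Proof.
by move=> xK xy yD; rewrite !inE/= yD; apply/orP; right; apply/bndP; exists x.
Qed.

Lemma explored_sub D Z K : (explored D Z K `<=` D)%fset.
Proof. by apply/fsubsetP => x; rewrite !inE => /andP[]. Qed.

Lemma explored_open D Z c x :
  x \in explored D Z (cluster D Z c) -> c x -> x \in cluster D Z c.
Proof.
rewrite !inE/= => /andP[xD /orP[Zx|/bndP[y yK yx]]] cx.
  by move: (cluster_seed Zx xD cx); rewrite !inE.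
by move: (cluster_step yK yx xD cx); rewrite !inE.
Qed.

(** The exploration inspects only seeds and neighbors of sites already found, and these all lie in
    [explored]. *)
Lemma cluster_agree D Z c c' :
  (forall x, x \in explored D Z (cluster D Z c) -> c x = c' x) ->
  cluster D Z c' = cluster D Z c.
Proof.
move=> cc'; apply/fsetP => x; apply/idP/idP => xK.
  apply: (cluster_ind (P := fun x => x \in cluster D Z c) xK) => [z Zz zD cz|u v uK uv vD cv].
    by apply: cluster_seed => //; rewrite cc'//; exact: explored_seed.
  by apply: (cluster_step uK uv vD); rewrite cc'//; apply: explored_step uK uv vD.
(* Agreement is known only next to the cluster of [c], so the induction has to carry that membership
   along. *)
pose P x := x \in cluster D Z c' /\ x \in cluster D Z c.
have : P x.
  apply: (cluster_ind (P := P) xK) => [z Zz zD cz|u v [uK' uK] uv vD cv].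
    split; last exact: cluster_seed.
    by apply: cluster_seed => //; rewrite -cc'//; exact: explored_seed.
  split; last exact: cluster_step uK uv vD cv.
  by apply: (cluster_step uK' uv vD); rewrite -cc'//; apply: explored_step uK uv vD.
by case.
Qed.

Lemma cluster_determined D Z : determined (fun x => x \in D) (cluster D Z).
Proof.
move=> c c' cc'; apply/esym/cluster_agree => x xK; apply: cc'.
exact: (fsubsetP (explored_sub _ _ _)) xK.
Qed.

(** The explored set is a stopping set; this is the form in which [expect_markov] asks for it. *)
Lemma cluster_eq_determined D Z K :
  determined (fun x => x \in explored D Z K) (fun c => cluster D Z c == K).
Proof.
have half c c' : (forall x, x \in explored D Z K -> c x = c' x) ->
    cluster D Z c = K -> cluster D Z c' = K.
  by move=> cc' cK; rewrite -[RHS]cK; apply: cluster_agree; rewrite cK.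
move=> c c' cc'; apply/eqP/eqP; first exact: half.
by apply: half => x xK; rewrite cc'.
Qed.

Definition rim L : pred V := fun x => ~~ (nb x `<=` L)%fset.

(** Stated from the rim inwards, so that a single exploration from the exterior decides it for all
    sites at once. *)
Definition escape L x c := x \in cluster L (rim L) c.

Lemma rimP L x : reflect (exists2 y, adj x y & y \notin L) (rim L x).
Proof.
apply: (iffP (fsubsetPn _ _)) => -[y]; first by rewrite nbP; exists y.
by move=> xy yL; exists y; rewrite ?nbP.
Qed.

(** A path leaving [L] passes through the rim just before its first exit. *)
Lemma escapeI L c x z :
  reach c x z -> x \in L -> (z \notin L) || rim L z -> escape L x c.
Proof.
move=> cxz xL zL; apply/clusterP.
have [xz|[u [v [xu uv vL]]]] := reach_first_exit cxz xL; last first.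
  by exists u; [apply/rimP; exists v|exact: reach_sym].
exists z; last exact: reach_sym.
by have /andP[_ zL'] := reach_end xz; move: zL; rewrite (zL' : z \in L).
Qed.

Lemma escapeE L c x : escape L x c ->
  exists2 z, rim L z & reach (fun u => c u && (u \in L)) x z.
Proof. by move=> /clusterP[z Lz zx]; exists z => //; exact: reach_sym. Qed.

Lemma escape_determined L x : determined (fun u => u \in L) (escape L x).
Proof. by move=> c c' cc'; rewrite /escape (@cluster_determined L (rim L) c c'). Qed.

Lemma escape_mono L x c c' :
  (forall u, c u ==> c' u) -> escape L x c -> escape L x c'.
Proof. exact: cluster_mono. Qed.

Lemma rim_sub L L' z : (L' `<=` L)%fset -> rim L z -> rim L' z.
Proof.
move=> L'L /rimP[y zy yL]; apply/rimP; exists y => //.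
by apply: contraNN yL => /(fsubsetP L'L).
Qed.

(** The path to the rim must leave [K], since the sites of [S] have all their neighbors in [L].
    After its last visit to [K] it meets no explored site, because open explored sites belong to
    [K]; its first site from then on is [y]. *)
Lemma escape_via S L (o : V) c : o \in S -> (S `<=` L)%fset -> (bnd S `<=` L)%fset ->
  escape L o c ->
  let K := cluster S (pred1 o) c in
  exists2 y, y \in (bnd K `\` S)%fset &
    forall L', (L' `<=` L)%fset -> y \in L' ->
      escape L' y (fun u => c u && (u \notin explored S (pred1 o) K)).
Proof.
move=> oS SL bSL /escapeE[z zL oz] K.
have /andP[co _] := reach_start oz.
have oK : o \in K by apply: cluster_seed => //=.
have zK : z \notin K.
  apply/negP => /(fsubsetP (cluster_sub _ _ _)) zS.
  have /rimP[y zy] := zL; rewrite (fsubsetP bSL)//.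
  by apply/bndP; exists z.
have [u [y [uK uy yz]]] := reach_last_exit oz oK zK.
have /andP[/andP[cy yL] yK] := reach_start yz.
have yS : y \notin S.
  by apply: contra yK => yS; exact: cluster_step uK uy yS cy.
exists y; first by rewrite in_fsetD yS; apply/bndP; exists u.
move=> L' L'L yL'; apply: (escapeI (z := z)) => //; last first.
  by rewrite (rim_sub L'L zL) orbT.
apply: reach_mono yz => v /andP[/andP[cv vL] vK]; rewrite cv/=.
by apply: contra vK => vE; exact: explored_open.
Qed.

End Exploration.

(** * The Duminil-Copin--Tassion inequalities *)

Section FiniteCriterion.
Variables (R : realType) (V : choiceType) (adj : rel V) (nb : V -> {fset V}).
Hypotheses (adj_sym : symmetric adj) (nbP : forall x y, (y \in nb x) = adj x y).
Implicit Types (c : V -> bool) (L S K : {fset V}) (o : V) (q : R).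

Local Notation cluster := (cluster adj).
Local Notation explored := (explored nb).
Local Notation bnd := (bnd nb).
Local Notation escape := (escape adj nb).
Local Notation Eq q := (expect (bernoulli_weight (fun=> q))).

Definition theta L o q : R := Eq q L (fun c => (escape L o c)%:R) (fun=> false).

(* The quantity phi_q(S) of Duminil-Copin and Tassion: the expected number of
   sites outside S adjacent to the cluster of o in S. *)
Definition phi q S o : R :=
  Eq q S (fun c => (#|` bnd (cluster S (pred1 o) c) `\` S|%fset)%:R) (fun=> false).

Lemma natr_card K (x : R) : (#|` K|%fset)%:R * x = \sum_(y <- K) x.
Proof. by rewrite big_const_seq count_predT iter_addr addr0 mulr_natl. Qed.

Lemma bernoulli_cst_stochastic q : 0 <= q <= 1 ->
  stochastic (bernoulli_weight (fun _ : V => q)).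
Proof. by move=> q01; exact: stochastic_bernoulli. Qed.

Lemma theta_support L L' o q c : 0 <= q <= 1 -> (L `<=` L')%fset ->
  Eq q L' (fun c => (escape L o c)%:R) c = theta L o q.
Proof.
move=> q01 LL'; apply: (@expect_support _ _ _ _ _ _ _ _ _ (fun x => x \in L)).
- exact: bernoulli_cst_stochastic.
- by move=> d d' dd'; rewrite (escape_determined nbP o dd').
- exact: (fsubsetP LL').
- by [].
Qed.

Lemma escape_increasing L o :
  increasing (fun c => (escape L o c)%:R : R).
Proof.
move=> c c' cc'; rewrite ler_nat.
have := escape_mono (adj := adj) (nb := nb) (L := L) (x := o) cc'.
by case: (escape L o c) => // ->.
Qed.

Lemma theta_ge0 L o q : 0 <= q <= 1 -> 0 <= theta L o q.
Proof.
move=> q01; have w_st := bernoulli_cst_stochastic q01.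
rewrite -(expect_cst L 0 (fun=> false) w_st).
by apply: le_expect.
Qed.

Lemma theta_le1 L o q : 0 <= q <= 1 -> theta L o q <= 1.
Proof.
move=> q01; have w_st := bernoulli_cst_stochastic q01.
rewrite -(expect_cst L 1 (fun=> false) w_st).
by apply: le_expect => // c; case: escape.
Qed.

Lemma theta_nondecreasing L o q q' : 0 <= q <= q' -> q' <= 1 ->
  theta L o q <= theta L o q'.
Proof.
by move=> qq' q'1; apply: expect_bernoulli_le => //; exact: escape_increasing.
Qed.

Lemma phi_support L S o q c : 0 <= q <= 1 -> (S `<=` L)%fset ->
  Eq q L (fun c => (#|` bnd (cluster S (pred1 o) c) `\` S|%fset)%:R) c = phi q S o.
Proof.
move=> q01 SL; apply: (@expect_support _ _ _ _ _ _ _ _ _ (fun x => x \in S)).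
- exact: bernoulli_cst_stochastic.
- by move=> d d' dd'; rewrite (cluster_determined nbP (pred1 o) dd').
- exact: (fsubsetP SL).
- by [].
Qed.

(** After the last visit to the cluster of [o], the path uses only unexplored sites, which are still
    independent of the cluster; sum over the site [y] outside [S] where this last piece starts. *)
Lemma theta_le_phi S L o q (h : R) (L' : V -> {fset V}) : 0 <= q <= 1 ->
  o \in S -> (S `<=` L)%fset -> (bnd S `<=` L)%fset ->
  (forall y, y \in (bnd S `\` S)%fset ->
    [/\ L' y `<=` L, y \in L' y & theta (L' y) y q <= h]%fset) ->
  theta L o q <= phi q S o * h.
Proof.
move=> q01 oS SL bSL L'h; have w_st := bernoulli_cst_stochastic q01.
pose f K c : R := \sum_(y <- (bnd K `\` S)%fset)
  (escape (L' y) y (fun u => c u && (u \notin explored S (pred1 o) K)))%:R.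
have bndS K y : (K `<=` S)%fset -> y \in (bnd K `\` S)%fset -> y \in (bnd S `\` S)%fset.
  move=> KS; rewrite !in_fsetD => /andP[-> /(bndP nbP)[x xK xy]].
  by apply/(bndP nbP); exists x => //; exact: (fsubsetP KS).
apply: (@le_trans _ _ (Eq q L (fun c => f (cluster S (pred1 o) c) c) (fun=> false))).
  apply: le_expect => // c.
  have [esc|_] := boolP (escape L o c); last exact: sumr_ge0.
  have [y yK escy] := escape_via adj_sym nbP oS SL bSL esc.
  have [L'L yL' _] := L'h y (bndS _ _ (cluster_sub _ _ _ _) yK).
  rewrite /f (big_fsetD1 y yK)/= escy// lerDl.
  exact: sumr_ge0.
rewrite (expect_markov (L := fpowerset S)
  (Q := fun K x => x \in explored S (pred1 o) K) L _ w_st); last 3 first.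
- by move=> c; rewrite fpowersetE cluster_sub.
- by move=> K; exact: cluster_eq_determined.
- move=> K KS c c' cc'; apply: eq_bigr => y _; congr ((escape _ _ _)%:R).
  apply/funext => u; case: (boolP (u \in explored S (pred1 o) K)).
    by rewrite !andbF.
  by move=> uK; rewrite cc'.
rewrite mulrC -(phi_support o (fun=> false) q01 SL) -expectZ; apply: le_expect => // c.
rewrite expect_sum mulrC natr_card big_seq [leRHS]big_seq; apply: ler_sum => y yK.
have [L'L yL' esc_h] := L'h y (bndS _ _ (cluster_sub _ _ _ _) yK).
apply: (le_trans _ esc_h); rewrite -(theta_support y (fun=> false) q01 L'L).
(* Making the explored sites available again can only help to escape. *)
by apply: le_expect => // d; apply: escape_increasing => u; apply/implyP => /andP[].
Qed.

(** Applied to the increment of [escape] at [v], which ignores the state of [v]; this is the origin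
    of the factor 1 - q below. *)
Lemma expect_pivotal_closed L v q (G : (V -> bool) -> R) : 0 <= q <= 1 ->
  v \in L -> determined (predC (pred1 v)) G ->
  Eq q L (fun c => (~~ c v)%:R * G c) (fun=> false) =
  (1 - q) * Eq q L G (fun=> false).
Proof.
move=> q01 vL Gv; have w_st := bernoulli_cst_stochastic q01.
have v_det : determined (pred1 v) (fun c => (~~ c v)%:R : R).
  by move=> c c' cc'; rewrite cc'//=.
rewrite (expectM _ _ w_st v_det Gv); congr (_ * _).
rewrite (expect_support (s' := [:: v]) _ (fun=> false) w_st v_det)/=.
- by rewrite big_bool/= /upd eqxx /bernoulli_weight/= mulr0 mulr1 add0r.
- by move=> x /eqP ->.
- by move=> x /eqP ->; rewrite mem_head.
Qed.

(* Given the cluster B of the exterior of L, the sites of S = L \ explored B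
   are still independent, every site of bnd S is closed and adjacent to the
   exterior or to B, hence is pivotal as soon as the cluster of o in S is
   adjacent to it: there are phi q S o such sites on average. *)
Lemma russo_lower_bound L o q : 0 <= q <= 1 -> o \in L ->
  (forall S, o \in S -> 1 <= phi q S o) ->
  1 - theta L o q <= (1 - q) * \sum_(v <- L) Eq q L (fun c =>
    (escape L o (upd c v true))%:R - (escape L o (upd c v false))%:R) (fun=> false).
Proof.
move=> q01 oL phi1; have w_st := bernoulli_cst_stochastic q01.
pose B c := cluster L (rim nb L) c.
pose S K := (L `\` explored L (rim nb L) K)%fset.
(* A lower bound for the number of closed pivotal sites: none if [o] escapes, [o] itself if it was
   inspected and found closed, otherwise the sites bordering its cluster in the unexplored
   region. *)
pose f K c : R := if o \in K then 0 else
  if o \in explored L (rim nb L) K then 1 else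
  (#|` bnd (cluster (S K) (pred1 o) c) `\` S K|%fset)%:R.
(* Given [B], the mean of [f] is at least 1 unless [o] escapes. *)
apply: (@le_trans _ _ (Eq q L (fun c => f (B c) c) (fun=> false))).
  rewrite (expect_markov (L := fpowerset L)
    (Q := fun K x => x \in explored L (rim nb L) K) L _ w_st); last 3 first.
  - by move=> c; rewrite fpowersetE cluster_sub.
  - by move=> K; exact: cluster_eq_determined.
  - move=> K _ c c' cc'; rewrite /f.
    rewrite (@cluster_determined _ _ _ nbP (S K) (pred1 o) c c')// => x.
    by rewrite in_fsetD => /andP[+ _] => /cc'.
  rewrite -[X in X - _](expect_cst L 1 (fun=> false) w_st) -expectN -expectD.
  apply: le_expect => // c; rewrite /escape -/(B c) /f.
  have [oB|oB] := boolP (o \in B c); first by rewrite /= subrr expect_cst.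
  have [oE|oE] := boolP (o \in explored L (rim nb L) (B c)).
    by rewrite /= subr0 expect_cst.
  rewrite /= subr0.
  rewrite phi_support ?fsubsetDl//; apply: phi1.
  by rewrite in_fsetD oE.
rewrite mulr_sumr (eq_big_seq (fun v => Eq q L (fun c => (~~ c v)%:R *
    ((escape L o (upd c v true))%:R - (escape L o (upd c v false))%:R)) (fun=> false))); last first.
  move=> v vL; rewrite expect_pivotal_closed// => c c' cc'.
  by have E b : upd c v b = upd c' v b; [apply/funext => x; rewrite /upd;
    case: eqVneq => // xv; exact: cc'|rewrite !E].
rewrite -expect_sum; apply: le_expect => // c.
have mono v : escape L o (upd c v false) -> escape L o (upd c v true).
  by apply: escape_mono => x; rewrite /upd; case: eqVneq => // _; exact: implybb.
have T_ge0 v : 0 <= (~~ c v)%:R *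
    ((escape L o (upd c v true))%:R - (escape L o (upd c v false))%:R) :> R.
  by rewrite mulr_ge0// subr_ge0 ler_nat; case: escape (mono v) => // ->.
have up v x : c x ==> upd c v true x.
  by rewrite /upd; case: eqVneq => // _; rewrite ?implybT ?implybb.
have joins v : v \in explored L (rim nb L) (B c) ->
    v \in cluster L (rim nb L) (upd c v true).
  rewrite !inE/= => /andP[vL /orP[vrim|/(bndP nbP)[x xB xv]]].
    by move: (cluster_seed adj (c := upd c v true) vrim vL); rewrite !inE /upd eqxx; apply.
  have := cluster_step (cluster_mono (up v) xB) xv vL.
  by rewrite !inE {1}/upd eqxx; apply.
rewrite /f; case: ifPn => oB; first by apply: sumr_ge0 => v _; exact: T_ge0.
have T1 v : v \in explored L (rim nb L) (B c) -> v \notin B c ->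
    escape L o (upd c v true) -> (~~ c v)%:R *
    ((escape L o (upd c v true))%:R - (escape L o (upd c v false))%:R) = 1 :> R.
  move=> vE vB ->; have cv : c v = false by apply: contraNF vB; exact: explored_open.
  have -> : upd c v false = c by rewrite -cv upd_id.
  by rewrite /escape -/(B c) (negPf oB) cv subr0 mulr1.
case: ifPn => oE.
  by rewrite (big_fsetD1 o oL)/= T1// ?lerDl; [exact: sumr_ge0|exact: joins].
set SB := S (B c); set M := (bnd _ `\` _)%fset.
(* The unexplored neighbor [u] of [y] would be a seed if [y] were outside [L], and explored if [y]
   were in [B c]. Opening [y] joins the cluster of [o] to the exterior cluster. *)
have ME y : y \in M -> [/\ y \in L, y \in explored L (rim nb L) (B c), y \notin B c &
    escape L o (upd c y true)].
  rewrite in_fsetD => /andP[yS /(bndP nbP)[u uK uy]].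
  have := fsubsetP (cluster_sub _ _ _ _) _ uK; rewrite in_fsetD => /andP[uE uL].
  have yL : y \in L.
    apply: contraNT uE => yL; apply: explored_seed => //.
    by apply/(rimP nbP); exists y.
  have yE : y \in explored L (rim nb L) (B c).
    by apply: contraNT yS => yE; rewrite in_fsetD yE.
  split=> //.
    by apply: contraNN uE => yB; apply: (explored_step nbP (rim nb L) yB) => //; rewrite adj_sym.
  have /clusterP[z zrim zy] := joins y yE.
  have /clusterP[x /eqP xo ou] := uK; rewrite xo in ou.
  have uo : reach adj (fun v => upd c y true v && (v \in L)) u o.
    apply/(reach_sym adj_sym); apply: reach_mono ou => v /andP[cv].
    by rewrite in_fsetD => /andP[_ ->]; rewrite (implyP (up y v)).
  apply/clusterP; exists z => //; apply: (reach_trans _ uo).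
  apply: (reach_step zy); first by rewrite adj_sym.
  exact: reach_start uo.
rewrite (bigID (mem M))/= -big_filter (perm_big M)/=; last first.
  apply: uniq_perm; rewrite ?filter_uniq ?fset_uniq// => y.
  by rewrite mem_filter/=; case: (boolP (y \in M)) => // /ME[->].
rewrite big_seq (eq_bigr (fun=> 1)) => [|y /ME[_ yE yB yesc]]; last exact: T1.
by rewrite -big_seq -natr_card mulr1 lerDl sumr_ge0.
Qed.

(** Integrated form of theta' >= (1 - theta) / (1 - q): apply the mean value theorem, bound 1 - q by
    1, and use monotonicity to replace theta at the intermediate point by theta at [q1]. *)
Lemma theta_lower_bound L o q0 q1 : 0 <= q0 < q1 -> q1 <= 1 -> o \in L ->
  (forall q S, q0 < q < q1 -> o \in S -> 1 <= phi q S o) ->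
  (q1 - q0) * (1 - theta L o q1) <= theta L o q1.
Proof.
move=> /andP[q00 q01] q11 oL phi1.
pose d (x : R) : R := \sum_(v <- L) Eq x L (fun c =>
    (escape L o (upd c v true))%:R - (escape L o (upd c v false))%:R) (fun=> false).
have der (x : R) : is_derive x 1 (theta L o) (d x).
  exact: is_derive_expect_bernoulli (fset_uniq _).
have cont : {within `[q0, q1], continuous (theta L o)}.
  apply: continuous_subspaceT => x.
  have [ex _] := der x; apply: differentiable_continuous.
  exact/derivable1_diffP.
have [q] := MVT q01 (fun x _ => der x) cont.
rewrite in_itv/= => /andP[q0q qq1] dE.
have q_ge0 : 0 <= q by exact: le_trans (ltW q0q).
have q_le1 : q <= 1 by exact: le_trans (ltW qq1) q11.
have lb : 1 - theta L o q <= (1 - q) * d q.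
  apply: russo_lower_bound => //; first by rewrite q_ge0.
  by move=> S; apply: phi1; rewrite q0q.
have thq : theta L o q <= theta L o q1.
  by apply: theta_nondecreasing => //; rewrite q_ge0 ltW.
have th1 : theta L o q1 <= 1 by apply: theta_le1; rewrite (le_trans q_ge0 (ltW qq1)).
have th0 : 0 <= theta L o q0 by apply: theta_ge0; rewrite q00 (le_trans (ltW q01)).
have dq : 1 - theta L o q1 <= d q.
  have d0 : 0 <= (1 - q) * d q by lra.
  have q1' : 0 < 1 - q by rewrite subr_gt0 (lt_le_trans qq1).
  rewrite pmulr_rge0// in d0.
  by nra.
by nra.
Qed.

End FiniteCriterion.

(** * Cylinder events of the product measure *)

Section IidCylinders.
Variables (R : realType) (I : countType) (C : pointedFinType) (w : C -> R).
Variable mu : probability (config I C) R.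
Hypothesis mu_iid : iid_law w mu.

Lemma measurable_cylinder (J : {fset I}) (a : I -> C) :
  measurable ([set c | forall i, i \in J -> c i = a i] : set (config I C)).
Proof.
rewrite (_ : [set c | _] = \bigcap_(i in [set` J]) [set c : config I C | c i = a i]).
  apply: fin_bigcap_measurable => // i _; apply: sub_sigma_algebra.
  by exists i, (a i).
by apply/seteqP; split => c /= H i; exact: H.
Qed.

(** The sites of [J] are already revealed, those of [s] still averaged; the induction reveals the
    first site of [s]. *)
Lemma iid_cylinder (A : (I -> C) -> bool) (s : seq I) (J : {fset I}) a :
  uniq s -> {in s, forall v, v \notin J} ->
  determined [pred x | (x \in J) || (x \in s)] A ->
  let E := [set c : config I C | (forall i, i \in J -> c i = a i) /\ A c] in
  measurable E /\
  mu E = ((\prod_(i <- J) w (a i)) * expect (fun=> w) s (fun c => (A c)%:R) a)%:E.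
Proof.
elim: s J a => [|v s IH] J a.
  move=> _ _ A_det E; have -> : E = if A a then [set c | forall i, i \in J -> c i = a i] else set0.
    have AE c : (forall i, i \in J -> c i = a i) -> A c = A a.
      by move=> ca; apply: A_det => x; rewrite inE/= orbF; exact: ca.
    apply/seteqP; split => [c /= [ca]|c]; first by rewrite AE// => ->.
    by case: ifPn => // Aa /= ca; split; rewrite ?AE.
  case: ifPn => Aa /=; last by rewrite (negPf Aa) mulr0 measure0.
  by split; [exact: measurable_cylinder|rewrite Aa mulr1 mu_iid].
move=> /andP[vs us] vJ A_det E.
have vJ' : v \notin J by apply: vJ; rewrite mem_head.
pose E' x := [set c : config I C | (forall i, i \in (v |` J)%fset -> c i = upd a v x i) /\ A c].
have IHx x : measurable (E' x) /\ mu (E' x) =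
    ((\prod_(i <- (v |` J)%fset) w (upd a v x i)) *
      expect (fun=> w) s (fun c => (A c)%:R) (upd a v x))%:E.
  apply: IH => // [u us'|c c' cc'].
    rewrite in_fset1U negb_or vJ ?in_cons ?us' ?orbT// andbT.
    by apply: contraNneq vs => <-.
  apply: A_det => y /=; rewrite in_cons orbCA orbA => yy; apply: cc'.
  by rewrite /= in_fset1U.
have EE : E = \bigcup_(x in [set: C]) E' x.
  apply/seteqP; split => c /=.
    move=> [ca Ac]; exists (c v) => //; split => // i.
    by rewrite in_fset1U /upd; case: eqVneq => [->//|_ /=]; exact: ca.
  move=> [x _ [ca Ac]]; split => // i iJ; have := ca i.
  rewrite in_fset1U iJ orbT /upd => /(_ isT).
  by case: eqVneq iJ => // ->; rewrite (negPf vJ').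
have mE' x : measurable (E' x) by have [] := IHx x.
split; first by rewrite EE; apply: fin_bigcup_measurable => //; exact: finite_finset.
rewrite EE measure_fin_bigcup//; last 2 first.
- exact: finite_finset.
- move=> x y _ _ [c [[cx _] [cy _]]].
  by have := cx v (fset1U1 _ _); rewrite (cy v (fset1U1 _ _)) /upd eqxx.
rewrite (fsbigE (enum C)) ?enum_uniq//; last first.
  by move=> x _; rewrite mem_enum.
rewrite (eq_bigl xpredT) => [|x]; last by rewrite in_setT.
rewrite big_enum/= (eq_bigr (fun x => (\prod_(i <- J) w (a i) *
    (w x * expect (fun=> w) s (fun c => (A c)%:R) (upd a v x)))%:E)).
  by rewrite sumEFin -mulr_sumr.
move=> x _; rewrite (IHx x).2; congr EFin.
rewrite big_fsetU1//= {1}/upd eqxx -mulrA mulrCA; congr (_ * _).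
by apply: eq_big_seq => i iJ; rewrite /upd; case: eqVneq iJ => // ->; rewrite (negPf vJ').
Qed.

Lemma iid_expect (A : (I -> C) -> bool) (s : seq I) c0 : uniq s ->
  determined [pred x | x \in s] A ->
  measurable ([set c | A c] : set (config I C)) /\
  mu [set c | A c] = (expect (fun=> w) s (fun c => (A c)%:R) c0)%:E.
Proof.
move=> us A_det; have := @iid_cylinder A s fset0 c0 us.
rewrite (_ : [set c | _ /\ _] = [set c | A c]); last first.
  by apply/seteqP; split => c /=; [case|split].
rewrite big_seq_fset0 mul1r => H; exact: H.
Qed.

End IidCylinders.

(** * The body-centered cubic lattice *)

Lemma bccD u v : bcc u -> bcc v -> bcc (u + v).
Proof.
move=> /orP[/forallP u2|/forallP u2] /orP[/forallP v2|/forallP v2]; apply/orP;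
  [left|right|right|left]; apply/forallP => i; rewrite mxE;
  have /dvdzP[a ua] := u2 i; have /dvdzP[b vb] := v2 i; apply/dvdzP.
- by exists (a + b); lra.
- by exists (a + b); lra.
- by exists (a + b); lra.
- by exists (a + b + 1); lra.
Qed.

Lemma bccN u : bcc u -> bcc (- u).
Proof.
move=> /orP[/forallP u2|/forallP u2]; apply/orP; [left|right];
  apply/forallP => i; rewrite mxE; have /dvdzP[a ua] := u2 i; apply/dvdzP.
- by exists (- a); lra.
- by exists (- a - 1); lra.
Qed.

Definition translate (t v : cell) : cell :=
  exist _ (center t + center v) (bccD (svalP t) (svalP v)).

Definition opposite (t : cell) : cell := exist _ (- center t) (bccN (svalP t)).

Lemma center_inj : injective center.
Proof. exact: val_inj. Qed.

Lemma translateK t : cancel (translate t) (translate (opposite t)).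
Proof. by move=> v; apply: center_inj; rewrite /= addKr. Qed.

Lemma translateNK t : cancel (translate (opposite t)) (translate t).
Proof. by move=> v; apply: center_inj; rewrite /= addNKr. Qed.

Lemma translate0 t : translate t origin = t.
Proof. by apply: center_inj; rewrite /= addr0. Qed.

Lemma adjacent_translate t v w : adjacent (translate t v) (translate t w) = adjacent v w.
Proof. by rewrite /adjacent /= opprD addrACA subrr add0r. Qed.

Lemma adjacent_sym : symmetric adjacent.
Proof.
move=> v w; rewrite /adjacent -(opprB (center w)); set d := center w - center v.
congr (_ || _).
  by apply: eq_existsb => i; rewrite eqr_opp eqr_oppLR orbC.
by apply: eq_forallb => i; rewrite mxE eqr_opp eqr_oppLR orbC.
Qed.

Definition close (n : nat) (v w : cell) : bool :=
  [forall i, `|center w ord0 i - center v ord0 i| <= n%:Z].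

Lemma close_trans m n v u w : close m v u -> close n u w -> close (m + n) v w.
Proof.
move=> /forallP vu /forallP uw; apply/forallP => i.
rewrite (le_trans (ler_distD (center u ord0 i) _ _))// PoszD addrC lerD//.
Qed.

Lemma closexx n v : close n v v.
Proof. by apply/forallP => i; rewrite subrr normr0. Qed.

Lemma close_le m n v w : (m <= n)%N -> close m v w -> close n v w.
Proof. by move=> mn /forallP vw; apply/forallP => i; exact: le_trans (vw i) _. Qed.

Lemma close_translate n t v w : close n (translate t v) (translate t w) = close n v w.
Proof. by apply: eq_forallb => i; rewrite !mxE opprD addrACA subrr add0r. Qed.

Lemma adjacent_close v w : adjacent v w -> close 2 v w.
Proof.
move=> vw; apply/forallP => i; rewrite distrC; move: vw; rewrite /adjacent.
have -> : center v ord0 i - center w ord0 i = (center v - center w) ord0 i.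
  by rewrite !mxE.
case/orP => [/existsP[j /orP[]/eqP ->]|/forallP/(_ i)/orP[]/eqP ->] //.
  by rewrite mulmxnE !mxE; case: (_ && _).
by rewrite mxE mulmxnE !mxE; case: (_ && _).
Qed.

(** Coordinates are shifted by [n] into the range of ['I_(n.*2.+1)]; [pmap insub] discards the rows
    outside the lattice. *)
Definition box_seq (n : nat) : seq cell :=
  pmap insub [seq (\row_i ((f i)%:Z - n%:Z) : 'rV[int]_3) |
    f : {ffun 'I_3 -> 'I_(n.*2.+1)} <- enum {: {ffun 'I_3 -> 'I_(n.*2.+1)}}].

Lemma mem_box_seq n w : close n origin w -> w \in box_seq n.
Proof.
move=> /forallP w_n; rewrite mem_pmap_sub; apply/mapP.
have lt i : (absz (center w ord0 i + n%:Z)%R < n.*2.+1)%N.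
move: (w_n i); rewrite /= mxE subr0 /center.
  by move: (sval w ord0 i) => x; lia.
exists [ffun i => Ordinal (lt i)]; first by rewrite mem_enum.
apply/rowP => i; rewrite !mxE ffunE/=.
by move: (w_n i); rewrite /= mxE subr0 /center; move: (sval w ord0 i) => x; lia.
Qed.

Definition box (n : nat) (v : cell) : {fset cell} :=
  [fset w in [seq translate v u | u <- box_seq n] | close n v w]%fset.

Lemma in_box n v w : (w \in box n v) = close n v w.
Proof.
rewrite !inE/=; apply: andb_idl => vw; apply/mapP.
exists (translate (opposite v) w); last by rewrite translateNK.
apply: mem_box_seq; rewrite -(close_translate n v) translateNK.
by rewrite translate0.
Qed.

Lemma card_box n v : (#|` box n v| <= n.*2.+1 ^ 3)%N.
Proof.
apply: (@leq_trans (size [seq translate v u | u <- box_seq n])).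
  by apply: uniq_leq_size (fset_uniq _) _ => w; rewrite !inE => /andP[].
rewrite size_map size_pmap (leq_trans (count_size _ _))// !size_map -enumT -cardT.
by rewrite card_ffun !card_ord.
Qed.

Definition neighbors (v : cell) : {fset cell} :=
  [fset w in box 2 v | adjacent v w]%fset.

Lemma neighborsP v w : (w \in neighbors v) = adjacent v w.
Proof.
rewrite in_fset inE/= in_box; apply: andb_idl; exact: adjacent_close.
Qed.

Section CellPercolation.

Local Notation reach := (reach adjacent).
Local Notation escape := (escape adjacent neighbors).
Local Notation bnd := (bnd neighbors).
Local Notation rim := (rim neighbors).
Local Notation theta := (theta adjacent neighbors).
Local Notation phi := (phi adjacent neighbors).

Lemma reach_translate t c x z :
  reach (fun u => c (translate t u)) x z -> reach c (translate t x) (translate t z).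
Proof.
move=> xz; apply: (reach_ind (P := fun u => reach c _ (translate t u)) xz).
  exact: reach_refl.
by move=> u v xu uv cv; apply: reach_step xu _ cv; rewrite adjacent_translate.
Qed.

Lemma escape_translate t (L L' : {fset cell}) x c :
  (forall u, (translate t u \in L') = (u \in L)) ->
  escape L' (translate t x) c = escape L x (fun u => c (translate t u)).
Proof.
have half t' (M M' : {fset cell}) y d : (forall u, (translate t' u \in M') = (u \in M)) ->
    escape M y (fun u => d (translate t' u)) -> escape M' (translate t' y) d.
  move=> MM' /(escapeE adjacent_sym)[z /(rimP neighborsP)[w zw wM] yz].
  have /andP[_ yM] := reach_start yz.
  apply: (escapeI adjacent_sym neighborsP (z := translate t' z)).
  - by apply: reach_translate; apply: reach_mono yz => u /andP[].
  - by rewrite MM'.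
  - apply/orP; right; apply/(rimP neighborsP); exists (translate t' w).
      by rewrite adjacent_translate.
    by rewrite MM'.
move=> LL'; apply/idP/idP; last exact: half.
rewrite -{2}(translateK t x) => H; apply: half => [u|].
  by rewrite -LL' translateNK.
rewrite (_ : (fun _ => _) = c)//; apply/funext => u.
by rewrite translateNK.
Qed.

Section Lattice.
Variable R : realType.
Implicit Types q : R.

Lemma in_box_translate n t u : (translate t u \in box n t) = (u \in box n origin).
Proof. by rewrite !in_box -{1}(translate0 t) close_translate. Qed.

Lemma theta_translate n v q : 0 <= q <= 1 ->
  theta (box n v) v q = theta (box n origin) origin q.
Proof.
move=> q01; rewrite /(theta _ _ _).
rewrite (expect_support (s' := map (translate v) (box n origin)) _ (fun=> false)
  (bernoulli_cst_stochastic q01) (Q := fun x => x \in box n v)); last 3 first.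
- by move=> c c' cc'; rewrite (escape_determined neighborsP v cc').
- by [].
- move=> w wv; apply/mapP; exists (translate (opposite v) w).
    by rewrite -(in_box_translate n v) translateNK.
  by rewrite translateNK.
rewrite (expect_map _ _ _ _ (translateK v) (translateNK v)).
apply: eq_expect => c; rewrite -{2}(translate0 v).
rewrite (escape_translate _ _ (in_box_translate n v)); congr ((escape _ _ _)%:R).
by apply/funext => u; rewrite /= translateK.
Qed.

Lemma fset_in_box (S : {fset cell}) : exists M, (S `<=` box M origin)%fset.
Proof.
pose norm (w : cell) := (\sum_i absz (center w ord0 i))%N.
exists (\max_(w <- S) norm w)%N; apply/fsubsetP => w wS; rewrite in_box.
apply: (@close_le (norm w)); first exact: leq_bigmax_seq.
apply/forallP => i; rewrite /= mxE subr0.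
rewrite -abszE lez_nat /norm (bigD1 i)//=; exact: leq_addr.
Qed.

Lemma bnd_box M (S : {fset cell}) : (S `<=` box M origin)%fset ->
  (bnd S `<=` box (M + 2) origin)%fset.
Proof.
move=> /fsubsetP SM; apply/fsubsetP => y /(bndP neighborsP)[x xS xy].
rewrite in_box; apply: close_trans (adjacent_close xy).
by rewrite -in_box; exact: SM.
Qed.

Lemma phi_ge0 q S o : 0 <= q <= 1 -> 0 <= phi q S o.
Proof.
move=> q01; rewrite -(expect_cst S 0 (fun=> false) (bernoulli_cst_stochastic q01)).
by apply: le_expect => //; exact: bernoulli_cst_stochastic.
Qed.

(** If [S] lies in the box of radius [M], a cell next to [S] is within L = M + 2 of the origin, and
    its box of radius k * L fits into the one of radius (k + 1) * L; so [theta_le_phi] can be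
    iterated. *)
Lemma theta_box_decay q S : 0 <= q <= 1 -> origin \in S ->
  exists2 L, (0 < L)%N &
    forall k, theta (box (k * L) origin) origin q <= phi q S origin ^+ k.
Proof.
move=> q01 oS; have [M SM] := fset_in_box S.
exists (M + 2)%N; first by rewrite addn2.
elim=> [|k IH]; first by rewrite expr0 theta_le1.
rewrite exprS; apply: (le_trans _ (ler_wpM2l (phi_ge0 S origin q01) IH)).
have boxS m : (M <= m)%N -> (S `<=` box m origin)%fset.
  move=> Mm; apply: fsubset_trans SM _; apply/fsubsetP => x.
  by rewrite !in_box; exact: close_le.
apply: (theta_le_phi adjacent_sym neighborsP (L' := box (k * (M + 2)))) => //.
- by apply: boxS; lia.
- apply: fsubset_trans (bnd_box SM) _; apply/fsubsetP => x.
  by rewrite !in_box; apply: close_le; lia.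
- move=> y; rewrite in_fsetD => /andP[_ /(fsubsetP (bnd_box SM))].
  rewrite in_box => oy; split; last by rewrite theta_translate.
    apply/fsubsetP => x; rewrite !in_box mulSn; exact: close_trans.
  by rewrite in_box closexx.
Qed.

Lemma infinite_open_cluster c : infinite_set (open_cluster c origin) <->
  forall n, escape (box n origin) origin c.
Proof.
split=> [inf n|esc fin].
  apply: contrapT => /negP nesc; apply: inf.
  apply: (@sub_finite_set _ _ [set` box n origin]); last exact: finite_fset.
  move=> w ow; apply: contrapT => /negP wn; case/negP: nesc.
  apply: (escapeI adjacent_sym neighborsP (z := w)) => //.
    by rewrite in_box closexx.
  by rewrite wn.
(* Escaping a box two units larger than one containing the cluster would put a cell of the cluster
   next to the exterior of the larger box. *)
have /finite_fsetP[S SE] := fin; have [M SM] := fset_in_box S.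
have [z zrim oz] := escapeE adjacent_sym (esc (M + 2)%N).
have zS : z \in S.
  suff : open_cluster c origin z by rewrite SE.
  by apply: reach_mono oz => u /andP[].
have /(rimP neighborsP)[y zy] := zrim; apply/negP; rewrite negbK.
by apply: (fsubsetP (bnd_box SM)); apply/(bndP neighborsP); exists z.
Qed.

Let perc q := iid cell (site_weight q).

Lemma perc_escape q n : 0 <= q <= 1 ->
  let E := [set c : config cell bool | escape (box n origin) origin c] in
  measurable E /\ perc q E = (theta (box n origin) origin q)%:E.
Proof.
move=> q01; have pmf := site_weight_pmf q01.
have := @iid_expect _ _ _ _ _ (@iidP R cell bool _ pmf) (escape (box n origin) origin)
  (box n origin) (fun=> false) (fset_uniq _).
by apply=> c c' cc'; apply: (escape_determined neighborsP).
Qed.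

Lemma infinite_cluster_bigcap :
  [set c | infinite_set (open_cluster c origin)] =
  \bigcap_n [set c : config cell bool | escape (box n origin) origin c].
Proof.
apply/seteqP; split => c /=; first by move=> /infinite_open_cluster H n _; exact: H.
by move=> H; apply/infinite_open_cluster => n; exact: H.
Qed.

Lemma measurable_infinite_cluster :
  measurable ([set c | infinite_set (open_cluster c origin)] : set (config cell bool)).
Proof.
rewrite infinite_cluster_bigcap; apply: bigcapT_measurable => n; have q01 : 0 <= (0 : R) <= 1 by rewrite lexx ler01.
exact: (perc_escape n q01).1.
Qed.

Lemma perc_infinite_le q n : 0 <= q <= 1 ->
  (perc q [set c | infinite_set (open_cluster c origin)] <=
   (theta (box n origin) origin q)%:E)%E.
Proof.
move=> q01; have [mE <-] := perc_escape n q01; apply: le_measure.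
- by rewrite inE; exact: measurable_infinite_cluster.
- by rewrite inE.
- by move=> c; rewrite infinite_cluster_bigcap; exact.
Qed.

(** Continuity from above: the escape events decrease to the infinite cluster event. *)
Lemma theta_box_small q e : 0 <= q <= 1 -> 0 < e ->
  perc q [set c | infinite_set (open_cluster c origin)] = 0%E ->
  exists n, theta (box n origin) origin q < e.
Proof.
move=> q01 e0; rewrite infinite_cluster_bigcap => p0.
have : (perc q \o (fun n => [set c : config cell bool | escape (box n origin) origin c]))
    @ \oo --> 0%E.
  rewrite -p0; apply: nonincreasing_cvg_mu.
  - by rewrite (le_lt_trans (probability_le1 _ _))// ?ltry//; exact: (perc_escape 0 q01).1.
  - by move=> n; exact: (perc_escape n q01).1.
  - rewrite -infinite_cluster_bigcap; exact: measurable_infinite_cluster.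
  - move=> m n mn; apply/subsetPset => c /= /(escapeE adjacent_sym)[z zn oz].
    have mn' : (box m origin `<=` box n origin)%fset.
      by apply/fsubsetP => x; rewrite !in_box; exact: close_le.
    apply: (escapeI adjacent_sym neighborsP (z := z)).
    + by apply: reach_mono oz => u /andP[].
    + by rewrite in_box closexx.
    + by rewrite (rim_sub neighborsP mn' zn) orbT.
move=> /fine_cvgP[_ /cvgrPdist_lt/(_ e e0)[N _ /(_ N (leqnn N))]].
rewrite /= (perc_escape N q01).2/= sub0r normrN ger0_norm ?theta_ge0// => tN.
by exists N.
Qed.

End Lattice.

(** * Subcritical percolation on the lattice *)

Section Subcritical.
Variable R : realType.
Implicit Types q : R.

Definition degree : nat := #|` neighbors origin|%fset.

Lemma phi_origin q : 0 <= q <= 1 ->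
  phi q [fset origin]%fset origin <= q * degree%:R.
Proof.
move=> q01; have w_st := @bernoulli_cst_stochastic R cell q q01.
have det : determined (pred1 origin) (fun c : cell -> bool => (c origin)%:R : R).
  by move=> c c' cc'; rewrite cc'//=.
have <- : expect (bernoulli_weight (fun=> q)) [fset origin]%fset
    (fun c => degree%:R * (c origin)%:R) (fun=> false) = q * degree%:R.
  rewrite expectZ mulrC; congr (_ * _).
  rewrite (expect_support (s' := [:: origin]) _ (fun=> false) w_st det)/=.
  - by rewrite big_bool/= /upd eqxx /bernoulli_weight/= mulr0 mulr1 addr0.
  - by move=> x /eqP ->; rewrite inE.
  - by move=> x /eqP ->; rewrite mem_head.
apply: le_expect => // c; set K := cluster _ _ _ _.
have [co|co] := boolP (c origin).
  rewrite mulr1 ler_nat; apply: fsubset_leq_card; apply/fsubsetP => y.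
  rewrite in_fsetD => /andP[_ /(bndP neighborsP)[x xK xy]].
  have := fsubsetP (cluster_sub _ _ _ _) _ xK; rewrite inE => /eqP xo.
  by rewrite neighborsP -xo.
rewrite mulr0 (_ : _ `\` _ = fset0)%fset ?cardfs0//.
apply/fsetP => y; rewrite in_fset0; apply/negP.
rewrite in_fsetD => /andP[_ /(bndP neighborsP)[x xK _]].
have := fsubsetP (cluster_sub _ _ _ _) _ xK; rewrite inE => /eqP xo.
by move: (cluster_open xK); rewrite xo (negPf co).
Qed.

Lemma expr_small (r e : R) : 0 <= r < 1 -> 0 < e -> exists k, r ^+ k < e.
Proof.
move=> /andP[r0 r1] e0.
have : (fun k => r ^+ k) @ \oo --> (0 : R) by apply: cvg_expr; rewrite ger0_norm.
move=> /cvgrPdist_lt/(_ e e0)[N _ /(_ N (leqnn N))].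
by rewrite sub0r normrN ger0_norm ?exprn_ge0// => rN; exists N.
Qed.

Let zero_set : set R := [set q : R | 0 <= q <= 1 /\
  iid cell (site_weight q) [set c | infinite_set (open_cluster c origin)] = 0%E].

Lemma p_c_gt0 : 0 < p_c R.
Proof.
(* Makes phi of the single cell at most 1/2; the successor keeps the inverse meaningful without
   computing [degree]. *)
pose q : R := (2 * degree.+1%:R)^-1.
have D0 : 0 < degree.+1%:R :> R by rewrite ltr0n.
have q0 : 0 < q by rewrite invr_gt0 mulr_gt0.
have q01 : 0 <= q <= 1.
  rewrite ltW//= invf_le1 ?mulr_gt0//.
  have : 1 <= degree.+1%:R :> R by rewrite ler1n.
  lra.
have phi1 : phi q [fset origin]%fset origin < 1.
  apply: (le_lt_trans (phi_origin q01)).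
  rewrite /q invfM -mulrA; set y := _ * degree%:R; have : y <= 1.
    by rewrite /y mulrC ler_pdivrMr// mul1r ler_nat.
  lra.
apply: (lt_le_trans q0); apply: ub_le_sup; first by exists 1 => x [/andP[]].
split=> //; have [L L0 decay] := theta_box_decay q01 (fset11 origin).
apply/eqP; rewrite eq_le measure_ge0 andbT.
apply/lee_addgt0Pr => e e0; rewrite add0e.
have [k rk] : exists k, phi q [fset origin]%fset origin ^+ k < e.
  by apply: expr_small => //; rewrite phi1 phi_ge0.
apply: le_trans (perc_infinite_le (k * L) q01) _.
by rewrite lee_fin (le_trans (decay k))// ltW.
Qed.

(** A dichotomy: either phi < 1 for some finite set at a parameter between [q] and [q1], and
    [theta_box_decay] applies, or theta at [q1] is bounded below, against the absence of an infinite
    cluster there. *)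
Lemma subcritical_decay q : 0 <= q < p_c R -> exists L r,
  [/\ (0 < L)%N, 0 <= r < 1 & forall k, theta (box (k * L) origin) origin q <= r ^+ k].
Proof.
move=> /andP[q0 qpc].
(* The supremum of the empty set is 0, which q >= 0 excludes. *)
have [q1 [/andP[q10 q11] p0] qq1] : exists2 q1, zero_set q1 & q < q1.
  apply: sup_gt => //; have [E|/set0P//] := eqVneq zero_set set0.
  by move: qpc; rewrite /p_c -/zero_set E sup0 ltNge q0.
have [[q' [S [/andP[qq' q'q1] oS phi1]]]|nex] := pselect (exists q' S,
    [/\ q < q' < q1, origin \in S & phi q' S origin < 1]).
  have q'01 : 0 <= q' <= 1 by rewrite (le_trans q0 (ltW qq')) (le_trans (ltW q'q1)).
  have [L L0 decay] := theta_box_decay q'01 oS.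
  exists L, (phi q' S origin); split=> //; first by rewrite phi1 phi_ge0.
  move=> k; apply: le_trans (decay k); apply: theta_nondecreasing.
    by rewrite q0 ltW.
  by case/andP: q'01.
have q101 : 0 <= q1 <= 1 by rewrite q10.
(* Below this level theta < 1/2, so that (q1 - q) * (1 - theta) > theta. *)
have e0 : 0 < (q1 - q) / 2 by rewrite divr_gt0// subr_gt0.
have [n tn] := theta_box_small q101 e0 p0.
have := @theta_lower_bound R cell adjacent neighbors adjacent_sym neighborsP
  (box n origin) origin q q1.
rewrite q0 qq1 in_box closexx => /(_ isT q11 isT) lb.
have : (q1 - q) * (1 - theta (box n origin) origin q1) <= theta (box n origin) origin q1.
  apply: lb => q' S qq oS; rewrite leNgt; apply/negP => phi1; apply: nex.
  by exists q', S.
nra.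
Qed.

End Subcritical.

(** * Tricolor paths *)

Definition seen (i k : color) (c : cell -> color) : cell -> bool :=
  fun v => (c v == i) && has (fun w => c w == k) (neighbors v).

Lemma tricolor_edge_color (c : coloring) e a :
  tricolor_edge c e -> exists2 v, v \in e & c v = a.
Proof.
move=> [[e3 _] c_inj].
have card_ce : #|` [fset c v | v in e]%fset| = 3 by rewrite card_in_imfset.
have sub : ([fset c v | v in e] `<=` [fset x in color])%fset.
  by apply/fsubsetP => x _; rewrite inE.
have : [fset c v | v in e]%fset == [fset x in color]%fset.
  by rewrite -(fsubset_leqif_cards sub) card_ce card_finset card_ord.
move=> /eqP/fsetP/(_ a); rewrite inE => /imfsetP[v ve ->].
by exists v.
Qed.

Lemma seen_on_edge (c : coloring) e i k : i != k -> tricolor_edge c e ->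
  exists2 v, v \in e & seen i k c v.
Proof.
move=> ik ce; have [v ve cv] := tricolor_edge_color i ce.
have [w we cw] := tricolor_edge_color k ce.
exists v => //; rewrite /seen cv eqxx/=; apply/hasP; exists w; last by rewrite cw.
rewrite neighborsP; have [[_ e_adj] _] := ce; apply: e_adj => //.
by apply: contraNneq ik => vw; rewrite -cv -cw vw.
Qed.

(** Consecutive edges share a vertex, whose cells are mutually adjacent; hence the cells chosen on
    them are equal or adjacent. *)
Lemma tricolor_path_chain (c : coloring) i k x y s : i != k ->
  path (tricolor_step c) x (y :: s) ->
  exists v u, [/\ v \in x, u \in last y s & reach (seen i k c) v u].
Proof.
move=> ik; elim: s x y => [|z s IH] x y /= /andP[/asboolP[_ yvert _ [e [ce ex ey]]]].
  move=> _; have [v ve seen_v] := seen_on_edge ik ce.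
  exists v, v; split; [exact: (fsubsetP ex)|exact: (fsubsetP ey)|exact: reach_refl].
move=> /IH[v' [u [v'y us v'u]]]; have [v ve seen_v] := seen_on_edge ik ce.
exists v, u; split=> //; first exact: (fsubsetP ex).
have [->//|vv'] := eqVneq v v'.
by apply: reach_head v'u => //; apply: yvert.2 => //; exact: (fsubsetP ey).
Qed.

Lemma vertex_close x u v : is_vertex x -> u \in x -> v \in x -> close 2 u v.
Proof.
move=> [_ x_adj] ux vx; have [->|uv] := eqVneq u v; first exact: closexx.
by apply: adjacent_close; exact: x_adj.
Qed.

Lemma cube_close n v : cube n v <-> close n origin v.
Proof.
split=> [vn|/forallP vn]; last by move=> i; have := vn i; rewrite /= mxE subr0.
by apply/forallP => i; rewrite /= mxE subr0; exact: vn.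
Qed.

Lemma crossing_escape (c : coloring) i k n m : i != k -> (m + 4 <= 2 * n)%N ->
  crossing n c -> exists2 v, v \in box (n + 2) origin &
    escape (box m v) v (seen i k c).
Proof.
move=> ik mn [x [s [[xvert _ [a ax /cube_close an]] xs [lvert _ [b bl bn]]]]].
have far u : u \in last x s -> ~ close (3 * n - 2) origin u.
  move=> ul ou; apply/bn/cube_close.
  apply: (close_le (m := (3 * n - 2) + 2)); first by lia.
  exact: close_trans ou (vertex_close lvert ul bl).
have near v : v \in x -> close (n + 2) origin v.
  by move=> vx; exact: close_trans an (vertex_close xvert ax vx).
(* A path without edges is impossible, as its only vertex would be near both boundaries. *)
case: s xs lvert bl far => [_ _ _ far|y s xs _ _ far].
  by case: (far a) => //; apply: close_le an; lia.
have [v [u [vx ul vu]]] := tricolor_path_chain ik xs.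
exists v; first by rewrite in_box near.
apply: (escapeI adjacent_sym neighborsP vu); first by rewrite in_box closexx.
apply/orP; left; rewrite in_box; apply/negP => vum; apply: (far u) => //.
apply: (close_le (m := n + 2 + m)); first by lia.
exact: close_trans (near v vx) vum.
Qed.

(** The connecting edge is contained in [x]. *)
Lemma tricolor_step_determined x y :
  determined (fun v => v \in x) (fun c : cell -> color => tricolor_step c x y).
Proof.
have half (c c' : cell -> color) : (forall v, v \in x -> c v = c' v) ->
    tricolor_step c x y -> tricolor_step c' x y.
  move=> cc' /asboolP[xv yv xy [e [[ee e_inj] ex ey]]]; apply/asboolP.
  split=> //; exists e; split=> //; split=> // u v ue ve.
  by rewrite -!cc' ?(fsubsetP ex)//; exact: e_inj.
move=> c c' cc'; apply/idP/idP; first exact: half.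
by apply: half => v vx; rewrite cc'.
Qed.

Lemma tricolor_path_determined x s :
  determined (fun v => v \in (\bigcup_(z <- x :: s) z)%fset)
    (fun c : cell -> color => path (tricolor_step c) x s).
Proof.
move=> c c'; elim: s x => //= y s IH x cc'; congr (_ && _).
  apply: tricolor_step_determined => v vx; apply: cc'.
  by rewrite big_cons in_fsetU vx.
by apply: IH => v vs; apply: cc'; rewrite big_cons in_fsetU vs orbT.
Qed.

Lemma card_neighbors v : #|` neighbors v|%fset = degree.
Proof.
rewrite /degree; have -> : neighbors v = [fset translate v u | u in neighbors origin]%fset.
  apply/fsetP => w; apply/idP/imfsetP => [vw|[u /= ou ->]].
    exists (translate (opposite v) w); last by rewrite translateNK.
    by rewrite /= neighborsP -(adjacent_translate v) translateNK translate0 -neighborsP.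
  by rewrite neighborsP -{1}(translate0 v) adjacent_translate -neighborsP.
by rewrite card_imfset//; exact: can_inj (translateK v).
Qed.

Lemma count_adjacent v s : uniq s -> (count (adjacent v) s <= degree)%N.
Proof.
move=> us; rewrite -size_filter -(card_neighbors v).
apply: uniq_leq_size; first exact: filter_uniq.
by move=> w; rewrite mem_filter neighborsP => /andP[].
Qed.

(** * Comparison of the chain with thinned percolation *)

Lemma bernoulli_inequality (R : realType) (x : R) n :
  0 <= x <= 1 -> 1 - n%:R * x <= (1 - x) ^+ n.
Proof.
move=> /andP[x0 x1]; elim: n => [|n IH]; first by rewrite mul0r subr0 expr0.
rewrite exprS mulrSr; have x1' : 0 <= 1 - x by rewrite subr_ge0.
apply: le_trans (ler_wpM2l x1' IH); have n0 : 0 <= n%:R :> R by [].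
by nra.
Qed.

(** Divide by 1 - r: each of the k terms of 1 + r + ... + r ^+ k.-1 is at least r ^+ k. *)
Lemma natr_expr_le (R : realType) (r : R) k :
  0 <= r <= 1 -> k%:R * (1 - r) * r ^+ k <= 1 - r ^+ k.
Proof.
move=> /andP[r0 r1]; elim: k => [|k IH]; first by rewrite mul0r mul0r expr0 subrr.
rewrite exprS mulrSr; have rk0 : 0 <= r ^+ k by exact: exprn_ge0.
have rk1 : r ^+ k <= 1 by exact: exprn_ile1.
set y := r ^+ k in IH rk0 rk1 *; set n := k%:R in IH *.
have h : r * (n * (1 - r) * y) <= r * (1 - y) by rewrite ler_wpM2l.
have h2 : 0 <= (1 - r) * (1 - r * y).
  by rewrite mulr_ge0 ?subr_ge0// mulr_ile1.
nra.
Qed.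

Section Thinning.
Variable R : realType.

(** Equals 1 - (1 - t) ^+ degree for the [t] below, chosen so that t ^+ degree >= 1/2 by Bernoulli's
    inequality. *)
Definition thinning : R := 1 - (2 * degree.+1%:R)^-1 ^+ degree.

Let t : R := 1 - (2 * degree.+1%:R)^-1.

Let D2_gt0 : 0 < 2 * degree.+1%:R :> R.
Proof. by rewrite mulr_gt0// ltr0n. Qed.

Let t01 : 0 <= (2 * degree.+1%:R : R)^-1 <= 1.
Proof.
rewrite invr_ge0 ltW//= invf_le1//; have : 1 <= degree.+1%:R :> R by rewrite ler1n.
lra.
Qed.

Lemma thinning_ge0 : 0 <= thinning.
Proof. by rewrite subr_ge0; case/andP: t01 => ? ?; exact: exprn_ile1. Qed.

Lemma thinning_lt1 : thinning < 1.
Proof. by rewrite ltrBlDr ltrDl exprn_gt0// invr_gt0. Qed.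

Let half_le : 2^-1 <= t ^+ degree.
Proof.
apply: le_trans (bernoulli_inequality degree t01).
set y := degree%:R * _; have : y <= 2^-1.
  by rewrite ler_pdivrMr// mulKf ?ler_nat// pnatr_eq0.
lra.
Qed.

Variables (p : color -> R) (i j k : color).
Hypotheses (p_ge0 : forall a, 0 <= p a) (p_sum : \sum_a p a = 1).
Hypotheses (ij : i != j) (ik : i != k) (jk : j != k) (p_kj : p k <= p j).

Let ijk_perm : perm_eq (enum color) [:: i; j; k].
Proof.
have ijk_uniq : uniq [:: i; j; k] by rewrite /= !inE negb_or ij ik jk.
apply: uniq_perm; rewrite ?enum_uniq// => a.
have [||_ E] := @uniq_min_size _ [:: i; j; k] (enum color) ijk_uniq.
- by move=> b; rewrite mem_enum.
- by rewrite -cardE card_ord.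
- by rewrite E.
Qed.

Let color_cases a : [\/ a = i, a = j | a = k].
Proof.
have : a \in [:: i; j; k] by rewrite -(perm_mem ijk_perm) mem_enum.
by rewrite !inE => /or3P[]/eqP ->; [apply: Or31|apply: Or32|apply: Or33].
Qed.

Let p_sum3 : p i + p j + p k = 1.
Proof.
rewrite -p_sum -big_enum (perm_big _ ijk_perm)/= !big_cons big_nil.
by rewrite addr0 addrA.
Qed.

(** The conditional probability of [k] given a color other than [i]; it is 0 when p i = 1, by the
    convention on inverses. *)
Let g : R := p k / (1 - p i).

Let g_mul : (1 - p i) * g = p k.
Proof.
have [pi1|pi1] := eqVneq (1 - p i) 0; last by rewrite /g mulrCA divff// mulr1.
rewrite pi1 mul0r; have := p_sum3; have := p_ge0 k; have := p_ge0 j; lra.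
Qed.

Let g_half : 0 <= g <= 2^-1.
Proof.
have sum3 := p_sum3; have pj := p_ge0 j; have pk := p_ge0 k.
have q0 : 0 <= 1 - p i by lra.
rewrite divr_ge0//=; have [pi1|pi1] := eqVneq (1 - p i) 0.
  by rewrite /g pi1 invr0 mulr0 invr_ge0.
rewrite ler_pdivrMr ?lt_def ?pi1//; move: (p_kj) (p_sum3); move: (p i) (p j) (p k) => x y z; lra.
Qed.

(** The mark [m] is drawn even at cells of color [i], where it does not affect the color; this makes
    marks independent of the cells of color [i]. *)
Let paint (r m : bool) : color := if r then i else if m then k else j.

(** [s] must contain the neighbors of [U] too, since [seen] inspects them. *)
Lemma expect_seen_le (s : seq cell) (U : pred cell) (F : (cell -> bool) -> R) :
  uniq s -> {subset U <= s} ->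
  (forall v w, U v -> adjacent v w -> w \in s) ->
  increasing F -> determined U F ->
  expect (fun=> p) s (fun c => F (seen i k c)) (fun=> j) <=
  expect (bernoulli_weight (fun=> p i * thinning)) s F (fun=> false).
Proof.
move=> us Us nUs F_incr F_det.
have pi01 : 0 <= p i <= 1.
  have := p_sum3; have := p_ge0 i; have := p_ge0 j; have := p_ge0 k; lra.
have g01 : 0 <= g <= 1.
  by case/andP: g_half => -> /le_trans; apply; rewrite invf_le1// ler1n.
have F_le (c c' : cell -> bool) : (forall v, U v -> c v ==> c' v) -> F c <= F c'.
  move=> cc'; rewrite (F_det c (fun v => U v && c v)) => [|v ->//].
  by apply: F_incr => v; case: (boolP (U v)) => //= /cc'.
(* The constant coloring [j] is [paint false false]. *)
rewrite (@expect_push _ _ _ _ (fun _ (rm : bool * bool) => paint rm.1 rm.2)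
  (fun=> p) (fun v rm => bernoulli_weight (fun=> p i) v rm.1 *
    bernoulli_weight (fun=> g) v rm.2)
  s (fun c => F (seen i k c)) (fun v => (false, false))); last first.
  move=> v _ a; rewrite big_mkcond -(pair_bigA _ (fun r m => if paint r m == a
    then bernoulli_weight (fun=> p i) v r * bernoulli_weight (fun=> g) v m
    else 0))/= !big_bool /bernoulli_weight/=.
  have [->|->|->] := color_cases a; rewrite ?eqxx.
  - by rewrite ![_ == i]eq_sym (negPf ij) (negPf ik) !addr0 -mulrDr addrC subrK mulr1.
  - by rewrite (negPf ij) [k == j]eq_sym (negPf jk) !add0r mulrBr mulr1 g_mul; have := p_sum3; lra.
  - by rewrite (negPf ik) (negPf jk) !add0r addr0 g_mul.
rewrite expect_prod.
(* A neighbor of color [k] is marked; marks at cells of color [i] only add hits. *)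
apply: (@le_trans _ _ (expect (bernoulli_weight (fun=> p i)) s (fun r =>
    expect (bernoulli_weight (fun=> g)) s
      (fun m => F (fun v => r v && hit adjacent s s m v)) (fun=> false)) (fun=> false))).
  apply: le_expect => [|r]; first exact: stochastic_bernoulli.
  apply: le_expect => [|m]; first exact: stochastic_bernoulli.
  apply: F_le => v Uv; apply/implyP => /andP[/= cv /hasP[w]].
  rewrite neighborsP => vw /eqP cw; rewrite /hit (Us v Uv)/=.
  have -> /= : r v.
    by move: cv; rewrite /paint; case: (r v) => //; case: (m v);
      rewrite eq_sym ?(negPf ij) ?(negPf ik).
  apply/hasP; exists w; first exact: nUs vw.
  rewrite adjacent_sym vw andbT; move: cw; rewrite /paint.
  by case: (r w) => [ik'|]; [move: ik; rewrite ik' eqxx|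
    case: (m w) => // jk'; move: jk; rewrite jk' eqxx].
rewrite -(expect_andb (fun=> p i) (fun=> thinning) s F (fun=> false) (fun=> false)).
apply: le_expect => [|r]; first exact: stochastic_bernoulli.
have -> : thinning = 1 - (1 - t) ^+ degree by rewrite /thinning /t subKr.
apply: (@expect_hit_le _ _ adjacent s degree g t us g01 _ _ _ _
  (fun d => F (fun v => r v && d v))).
- by rewrite /t subr_ge0 lerBlDr lerDl andbC.
- by apply: le_trans half_le; case/andP: g_half.
- by move=> w; exact: count_adjacent.
- move=> w; rewrite (eq_count (a2 := adjacent w)); first exact: count_adjacent.
  by move=> v; rewrite /= adjacent_sym.
- move=> d d' dd'; apply: F_incr => v; have := dd' v.
  by case: (r v).
Qed.

End Thinning.

(** * The extended phase *)

Lemma exists_other_colors (i : color) :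
  exists j k : color, [/\ i != j, i != k & j != k].
Proof.
case: i => [[|[|[|//]]] i3]; [exists (inord 1), (inord 2)|
  exists (inord 0), (inord 2)|exists (inord 0), (inord 1)];
  by rewrite -!val_eqE /= !inordK.
Qed.

Section ExtendedPhase.
Variable R : realType.
Implicit Types p : 'rV[R]_3.

Lemma coloring_pmf p : color_simplex p -> is_pmf (fun a : color => p ord0 a).
Proof. by move=> [p01 p_sum]; split => // a; case/andP: (p01 a). Qed.

(** There are countably many paths, each tested on finitely many cells. *)
Lemma measurable_crossing p n : color_simplex p ->
  measurable (crossing n : set coloring).
Proof.
move=> /coloring_pmf pmf.
pose X (t : {fset cell} * seq {fset cell}) : set coloring := [set c |
  [/\ interior_boundary n t.1, path (tricolor_step c) t.1 t.2 &
      exterior_boundary n (last t.1 t.2)]].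
have mX t : measurable (X t).
  have [H|H] := pselect (interior_boundary n t.1 /\ exterior_boundary n (last t.1 t.2)).
    have [mP _] := @iid_expect _ _ _ _ _ (@iidP R cell color _ pmf)
      (fun c => path (tricolor_step c) t.1 t.2)
      (\bigcup_(z <- t.1 :: t.2) z)%fset (fun=> ord0) (fset_uniq _)
      (@tricolor_path_determined t.1 t.2).
    rewrite (_ : X t = [set c | path (tricolor_step c) t.1 t.2])//.
    by apply/seteqP; split => c /=; [case|case: H].
  rewrite (_ : X t = set0)//; apply/seteqP; split => c //= -[? _ ?].
  by apply: H.
rewrite (_ : crossing n = \bigcup_m
    if choice.unpickle m is Some t then X t else set0).
  by apply: bigcupT_measurable => m; case: choice.unpickle.
apply/seteqP; split => c /=.
  move=> [x [s xs]]; exists (choice.pickle (x, s)) => //.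
  by rewrite choice.pickleK.
by move=> [m _]; case: choice.unpickle => // -[x s] xs; exists x, s.
Qed.

Lemma thinned_weight p (i : color) : color_simplex p ->
  0 <= p ord0 i * thinning R <= 1.
Proof.
move=> [/(_ i)/andP[pi0 pi1] _]; have tau0 := thinning_ge0 R.
by rewrite mulr_ge0//= mulr_ile1// ltW// thinning_lt1.
Qed.

(** A union bound over the cells where the chain of a crossing can start. *)
Lemma crossing_le p (i j k : color) n m : color_simplex p ->
  i != j -> i != k -> j != k -> p ord0 k <= p ord0 j -> (m + 4 <= 2 * n)%N ->
  (coloring_law p (crossing n) <= (((n + 2).*2.+1 ^ 3)%:R *
    theta (box m origin) origin (p ord0 i * thinning R))%:E)%E.
Proof.
move=> p_simplex ij ik jk pkj mn; have pmf := coloring_pmf p_simplex.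
have [p_ge0 p_sum] := pmf; set q := p ord0 i * thinning R.
have q01 : 0 <= q <= 1 by exact: thinned_weight.
pose B := box (n + 2) origin; pose s := box (n + 2 + m + 2) origin.
pose A c := has (fun v => escape (box m v) v (seen i k c)) B.
have box_s v x : v \in B -> x \in box m v -> close (n + 2 + m) origin x.
  by rewrite !in_box; exact: close_trans.
have U_s v x : v \in B -> x \in box m v -> x \in s.
  by move=> vB xv; rewrite in_box; apply: close_le (box_s v x vB xv); lia.
have nU_s v x w : v \in B -> x \in box m v -> adjacent x w -> w \in s.
  move=> vB xv xw; rewrite in_box; apply: close_trans (adjacent_close xw).
  exact: box_s xv.
have A_det : determined [pred x | x \in s] A.
  move=> c c' cc'; apply: eq_in_has => v vB.
  apply: (escape_determined neighborsP) => x xv.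
  rewrite /seen cc'; last exact: U_s xv.
  congr (_ && _); apply: eq_in_has => w; rewrite neighborsP => xw.
  by rewrite cc'//; exact: (nU_s v x w).
have [mA muA] := @iid_expect _ _ _ _ _ (@iidP R cell color _ pmf) A s
  (fun=> j) (fset_uniq _) A_det.
apply: (@le_trans _ _ (coloring_law p [set c | A c])).
  apply: le_measure.
  - by rewrite inE; exact: measurable_crossing p_simplex.
  - by rewrite inE.
  move=> c /(crossing_escape ik mn)[v vB esc]; apply/hasP.
  by exists v.
rewrite /coloring_law muA lee_fin.
have w_st : stochastic (fun (_ : cell) (a : color) => p ord0 a) by move=> v.
apply: (@le_trans _ _ (expect (fun=> (fun a : color => p ord0 a)) s
    (fun c => \sum_(v <- B) (escape (box m v) v (seen i k c))%:R) (fun=> j))).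
  apply: le_expect => // c; rewrite /A; case: hasP => [[v vB esc]|_].
    by rewrite (big_fsetD1 v vB)/= esc lerDl sumr_ge0.
  exact: sumr_ge0.
rewrite expect_sum big_seq.
apply: (@le_trans _ _ (\sum_(v <- B | v \in B) theta (box m origin) origin q)).
  apply: ler_sum => v vB.
  apply: (le_trans (@expect_seen_le R _ i j k p_ge0 p_sum ij ik jk pkj s
    (fun x => x \in box m v) (fun d => (escape (box m v) v d)%:R) (fset_uniq _) _ _ _ _)).
  - by move=> x; exact: U_s.
  - by move=> x w; exact: nU_s.
  - exact: escape_increasing.
  - by move=> d d' dd'; rewrite (escape_determined neighborsP v dd').
  - rewrite -(theta_translate m v q01) (theta_support neighborsP v _ q01)//.
    by apply/fsubsetP => x; exact: U_s.
rewrite -big_seq -natr_card ler_wpM2r ?theta_ge0// ler_nat.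
exact: card_box.
Qed.

(** Three of the four factors r ^+ k absorb the cube, since k * r ^+ k is bounded; the fourth tends
    to 0. *)
Lemma cube_geometric_small (r C e : R) : 0 <= r < 1 -> 0 < e ->
  exists2 k, (0 < k)%N & (C * k%:R) ^+ 3 * r ^+ (4 * k) < e.
Proof.
move=> /andP[r0 r1] e0; have r1' : 0 < 1 - r by rewrite subr_gt0.
pose M := (`|C| / (1 - r)) ^+ 3 + 1.
have M0 : 0 < M by rewrite ltr_wpDl// exprn_ge0// divr_ge0// ltW.
have [k rk] : exists k, r ^+ k < e / M.
  by apply: expr_small; rewrite ?r0// divr_gt0.
exists k.+1 => //.
have rk0 : 0 <= r ^+ k.+1 by exact: exprn_ge0.
have rk' : r ^+ k.+1 < e / M.
  by apply: le_lt_trans rk; rewrite exprS ler_piMl ?exprn_ge0// ltW.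
have kr : k.+1%:R * r ^+ k.+1 <= (1 - r)^-1.
  have := @natr_expr_le R r k.+1; rewrite r0 ltW// => /(_ isT) h.
  rewrite -[_^-1]mul1r ler_pdivlMr// mulrAC; apply: le_trans h _.
  by rewrite lerBlDr lerDl.
have -> : (C * k.+1%:R) ^+ 3 * r ^+ (4 * k.+1) =
    (C * (k.+1%:R * r ^+ k.+1)) ^+ 3 * r ^+ k.+1.
  by rewrite mulnC exprM; ring.
apply: (@le_lt_trans _ _ (M * r ^+ k.+1)); last by rewrite mulrC -ltr_pdivlMr.
rewrite ler_wpM2r// (le_trans (ler_norm _))// normrX.
rewrite (@le_trans _ _ ((`|C| / (1 - r)) ^+ 3)) ?lerDl//.
rewrite lerXn2r ?nnegrE//; first by rewrite divr_ge0// ltW.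
by rewrite normrM ler_wpM2l// ger0_norm// mulr_ge0.
Qed.

Lemma extended_phase_le p (i : color) :
  extended_phase R p -> p_c R <= p ord0 i * thinning R.
Proof.
move=> [p_simplex [e e0 cross]]; rewrite leNgt; apply/negP => q_pc.
have [j [k [ij ik jk pkj]]] : exists j k : color,
    [/\ i != j, i != k, j != k & p ord0 k <= p ord0 j].
  have [j [k [ij ik jk]]] := exists_other_colors i.
  have [pkj|/ltW pjk] := leP (p ord0 k) (p ord0 j); first by exists j, k.
  by exists k, j; split => //; rewrite eq_sym.
have q01 := thinned_weight i p_simplex; have /andP[q0 _] := q01.
have [L [r [L0 r01 decay]]] : exists L r, [/\ (0 < L)%N, 0 <= r < 1 & forall k,
    theta (box (k * L) origin) origin (p ord0 i * thinning R) <= r ^+ k].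
  by apply: subcritical_decay; rewrite q0.
(* With n = 2lL + 2 and m = 4lL one has m + 4 = 2n, and 2(n + 2) + 1 = 4lL + 9 <= 13lL since lL >=
   1. *)
have [l l0 small] := cube_geometric_small (13 * L%:R) r01 e0.
have mn : ((4 * l) * L + 4 <= 2 * (2 * l * L + 2))%N by lia.
have n1 : (1 <= 2 * l * L + 2)%N by lia.
have := le_trans (cross _ n1) (crossing_le p_simplex ij ik jk pkj mn).
rewrite lee_fin leNgt => /negP; apply.
apply: le_lt_trans small; apply: ler_pM => //.
- exact: theta_ge0.
- rewrite natrX lerXn2r ?nnegrE// ?mulr_ge0//.
  rewrite -!natrM ler_nat; nia.
Qed.

Lemma mx_entry_le_norm (x : 'rV[R]_3) i : `|x ord0 i| <= `|x|.
Proof.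
rewrite [X in _ <= X]/Num.norm/= mx_normrE.
exact: (le_bigmax _ (fun ij => `|x ij.1 ij.2|) (ord0, i)).
Qed.

(** The bound is a closed condition on [p]. *)
Lemma closure_extended_phase_le p (i : color) :
  closure (extended_phase R) p -> p_c R <= p ord0 i * thinning R.
Proof.
move=> clp; rewrite leNgt; apply/negP => pi_lt.
have cont : continuous (fun x : 'rV[R]_3 => x ord0 i * thinning R).
  move=> x; apply: (@continuousM _ _ (fun M : 'rV[R]_3 => M ord0 i) (fun=> thinning R)).
    exact: coord_continuous.
  exact: cst_continuous.
have /clp[x [/(extended_phase_le i) x_ge]] :
    nbhs p [set x : 'rV[R]_3 | x ord0 i * thinning R < p_c R].
  exact: (cont p [set z | z < p_c R] (lt_nbhsl pi_lt)).
by rewrite /= ltNge x_ge.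
Qed.

End ExtendedPhase.

End CellPercolation.

Theorem corollary1p6 (R : realType) (i : color) :
  (0 < set_distance (simplex_boundary (extended_phase R))
                    (critical_line R i))%E /\
  (0 < set_distance (closure (extended_phase R)) (critical_line R i))%E.
Proof.
have tau1 := thinning_lt1 R; have tau0 := thinning_ge0 R; have pc0 := p_c_gt0 R.
(* If u is the i-th entry of a point of the closure, u * tau >= p_c gives u >= p_c and u - p_c >= u
   * (1 - tau) >= d. *)
pose d := p_c R * (1 - thinning R).
have d0 : 0 < d by rewrite mulr_gt0// subr_gt0.
suff dist A : A `<=` closure (extended_phase R) ->
    (0 < set_distance A (critical_line R i))%E.
  by split; apply: dist => // x [].
move=> Acl; apply: (@lt_le_trans _ _ d%:E); first by rewrite lte_fin.
apply: le_ereal_inf_tmp => _ [x Ax [y [_ yi] <-]]; rewrite lee_fin.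
have x_ge := closure_extended_phase_le i (Acl x Ax).
apply: le_trans (mx_entry_le_norm (x - y) i); rewrite !mxE yi.
apply: le_trans (ler_norm _); rewrite /d.
have xi0 : 0 <= x ord0 i.
  rewrite leNgt; apply/negP => xi_lt0; have : x ord0 i * thinning R <= 0.
    by rewrite mulr_le0_ge0// ltW.
  by move=> /(le_trans x_ge); rewrite leNgt pc0.
have x_pc : p_c R <= x ord0 i by apply: le_trans x_ge _; rewrite ler_piMr// ltW.
have : 0 <= (x ord0 i - p_c R) * (1 - thinning R) by rewrite mulr_ge0 ?subr_ge0// ltW.
move: x_ge; move: (x ord0 i) (p_c R) (thinning R) => u v w; lra.
Qed.
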